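(* Let $P(M,G)$ be a classical $G$-structure, i.e. a reductive $G$-structure on the bundle $LM$ of linear frames over $M$, with canonical decomposition $i_P^{*}(T(LM))=TP\oplus\mathcal M(P)$, where $i_P\colon P\to LM$ is the canonical embedding. Let $\xi$ be a vector field on $M$ and $L\xi$ its natural lift onto $LM$. Then the restriction $L\xi|_P$ of $L\xi$ to $P\to M$ splits into a $G$-invariant vector field $\xi_{\mathrm K}$ on $P$ (called the generalized Kosmann lift of $\xi$) and a transverse vector field $\xi_{\mathrm G}$ (called the von Göden lift of $\xi$), i.e. a section of $\mathcal M(P)$.
   Context: Let $m=\dim M$; $LM$ is a principal bundle over $M$ with structure group $H=GL(m,\mathbb R)$, with Lie algebra $\mathfrak h=\mathfrak{gl}(m,\mathbb R)$. A Lie subgroup $G\subset H$ with Lie algebra $\mathfrak g$ is reductive if there is a direct sum decomposition $\mathfrak h=\mathfrak g\oplus\mathfrak m$ with $\mathfrak m$ a vector subspace satisfying $\mathrm{Ad}_a(\mathfrak m)\subset\mathfrak m$ for all $a\in G$; such an $\mathfrak m$ is fixed. A reductive $G$-structure on $LM$ is a principal subbundle $P(M,G)$ of $LM$ over the same base $M$ whose structure group $G$ is a reductive Lie subgroup of $GL(m,\mathbb R)$. $\mathcal M(P)\to P$ is the vector subbundle of $i_P^{*}(V(LM))$ ($V(LM)$ the vertical bundle of $LM\to M$), isomorphic to $P\times\mathfrak m$, whose fibre at $u\in P$ is $\mathcal M_u=\{\frac{d}{dt}|_{t=0}u\cdot\exp(t\mu)\mid\mu\in\mathfrak m\}$; the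 canonical decomposition is $T_u(LM)=T_uP\oplus\mathcal M_u$ for each $u\in P$. Natural lift: a (local) diffeomorphism $\varphi$ of $M$ lifts to $L^1\varphi\colon LM\to LM$, $j^1_0\epsilon\mapsto j^1_0(\varphi\circ\epsilon)$ (frames being $1$-jets at $0$ of locally invertible maps $\epsilon\colon\mathbb R^m\to M$), and $L\xi:=\frac{\partial}{\partial t}L^1\varphi_t|_{t=0}$, where $\{\varphi_t\}$ is the flow of $\xi$. A vector field on $P$ is $G$-invariant if it is preserved by the tangent maps of all right translations by elements of $G$. *)

(* Defs.v *)
From HB Require Import structures.
From mathcomp Require Import all_boot all_order all_algebra.
From mathcomp Require Import all_classical all_reals all_analysis.

Set Implicit Arguments.
Unset Strict Implicit.
Unset Printing Implicit Defensive.

Import Order.TTheory GRing.Theory Num.Theory.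
Import numFieldNormedType.Exports.

Local Open Scope classical_set_scope.
Local Open Scope ring_scope.

(* For E finite-dimensional and U open, Ck k U f says that f is of class C^k
   on U in the usual sense: all directional derivatives D_v f are C^(k-1). *)
Fixpoint Ck (R : realType) (E F : normedModType R) (k : nat) (U : set E)
    (f : E -> F) : Prop :=
  if k is k'.+1 then
    (forall x, U x -> differentiable f x) /\
    (forall v : E, Ck k' U (fun x => 'D_v f x))
  else forall x, U x -> {for x, continuous f}.

Definition smooth_on (R : realType) (E F : normedModType R) (U : set E)
    (f : E -> F) : Prop :=
  forall k, Ck k U f.

(* Manifold structures on subsets of a type T, modelled on E: a structure is
   given by an atlas, and the union of the chart domains is the subset.  The
   topology is the one determined by the atlas (a set is open iff its images
   under all charts are), so that a Lie subgroup or a principal subbundle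
   carries its own structure, not necessarily the one induced from T. *)

Record chart (R : realType) (T : choiceType) (E : normedModType R) := Chart {
  chart_dom : set T;
  chart_map :> T -> E }.

(* The base point p only serves as a default value outside the image of c. *)
Definition chart_inv (R : realType) (T : choiceType) (E : normedModType R)
    (c : chart T E) (p : T) (y : E) : T :=
  xget p [set q | chart_dom c q /\ c q = y].

Definition support (R : realType) (T : choiceType) (E : normedModType R)
    (A : set (chart T E)) : set T :=
  [set p | exists2 c, A c & chart_dom c p].

Definition atlas_open (R : realType) (T : choiceType) (E : normedModType R)
    (A : set (chart T E)) (U : set T) : Prop :=
  U `<=` support A /\
  forall c, A c -> open (c @` (chart_dom c `&` U)).

(* f is C^oo on a neighbourhood of p, and maps it into the support of B. *)
Definition smooth_at (R : realType) (S T : choiceType) (E F : normedModType R)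
    (A : set (chart S E)) (B : set (chart T F)) (f : S -> T) (p : S) : Prop :=
  [/\ support A p, support B (f p) &
      forall c d, A c -> B d -> chart_dom c p -> chart_dom d (f p) ->
      exists V : set E,
        [/\ open V, V (c p), V `<=` c @` chart_dom c,
            (forall y, V y -> chart_dom d (f (chart_inv c p y))) &
            smooth_on V (fun y => d (f (chart_inv c p y)))]].

Definition full_atlas (R : realType) (E : normedModType R) :
    set (chart E E) :=
  [set @Chart R E E setT id].

Definition prod_atlas (R : realType) (S T : choiceType)
    (E F : normedModType R) (A : set (chart S E)) (B : set (chart T F)) :
    set (chart (S * T)%type (E * F)%type) :=
  [set e | exists c d, [/\ A c, B d &
     e = @Chart R (S * T)%type (E * F)%type
           (chart_dom c `*` chart_dom d) (fun z => (c z.1, d z.2))]].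

Record is_manifold (R : realType) (T : choiceType) (E : normedModType R)
    (S : set T) (A : set (chart T E)) : Prop := {
  manifold_support : support A = S;
  manifold_inj : forall c, A c -> set_inj (chart_dom c) c;
  manifold_overlap : forall c d, A c -> A d ->
    open (c @` (chart_dom c `&` chart_dom d));
  manifold_transition : forall c d p, A c -> A d ->
    chart_dom c p -> chart_dom d p -> smooth_at A (@full_atlas R E) d p;
  manifold_hausdorff : forall p q, S p -> S q -> p <> q ->
    exists U V, [/\ atlas_open A U, atlas_open A V, U p, V q &
                    U `&` V = set0];
  manifold_second_countable : exists B : nat -> set T,
    (forall n, atlas_open A (B n)) /\
    (forall U p, atlas_open A U -> U p ->
       exists n, B n p /\ B n `<=` U) }.

(* A tangent vector at p is given by its components v c in the charts c
   around p, related by the differentials of the transition maps; components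
   at the other charts are set to 0, so that equality of tangent vectors is
   Leibniz equality and the vector space operations are pointwise. *)

Notation tvec T E := (chart T%type E%type -> E%type).

Definition is_tangent (R : realType) (T : choiceType) (E : normedModType R)
    (A : set (chart T E)) (p : T) (v : tvec T E) : Prop :=
  (forall c, ~ (A c /\ chart_dom c p) -> v c = 0) /\
  (forall c d, A c -> A d -> chart_dom c p -> chart_dom d p ->
     v d = 'd (fun y : E => d (chart_inv c p y)) (c p) (v c)).

(* On tangent vectors the result does not depend on the chart c. *)
Definition tangent_map (R : realType) (S T : choiceType)
    (E F : normedModType R) (A : set (chart S E)) (B : set (chart T F))
    (f : S -> T) (p : S) (v : tvec S E) : tvec T F :=
  fun d => xget 0 [set w | [/\ B d, chart_dom d (f p) &
    exists c, [/\ A c, chart_dom c p &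
      w = 'd (fun y : E => d (f (chart_inv c p y))) (c p) (v c)]]].

(* The tangent vector at 0 of a curve. *)
Definition velocity (R : realType) (T : choiceType) (E : normedModType R)
    (A : set (chart T E)) (gamma : R -> T) : tvec T E :=
  fun c => if `[< A c /\ chart_dom c (gamma 0) >]
           then derive1 (fun t : R => c (gamma t)) 0 else 0.

Definition immersion_at (R : realType) (S T : choiceType)
    (E F : normedModType R) (A : set (chart S E)) (B : set (chart T F))
    (f : S -> T) (p : S) : Prop :=
  smooth_at A B f p /\
  forall v, is_tangent A p v ->
    tangent_map A B f p v = (fun=> 0) -> v = (fun=> 0).

Definition vector_field (R : realType) (T : choiceType)
    (E : normedModType R) (A : set (chart T E)) (X : T -> tvec T E) : Prop :=
  (forall p, support A p -> is_tangent A p (X p)) /\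
  (forall c p, A c -> chart_dom c p ->
     smooth_at A (@full_atlas R E) (fun q => X q c) p).

(* A smooth (not necessarily maximal) flow with flow domain D and
   infinitesimal generator xi. *)
Record is_flow (R : realType) (M : choiceType) (E : normedModType R)
    (A : set (chart M E)) (xi : M -> tvec M E)
    (D : set (R^o * M)) (phi : R -> M -> M) : Prop := {
  flow_open : atlas_open (prod_atlas (@full_atlas R R^o) A) D;
  flow_interval : forall x, is_interval [set t : R | D (t, x)];
  flow_zero : forall x, D (0, x);
  flow_smooth : forall z, D z ->
    smooth_at (prod_atlas (@full_atlas R R^o) A) A
      (fun z : R^o * M => phi z.1 z.2) z;
  flow_id : forall x, phi 0 x = x;
  flow_add : forall s t x, D (s, x) -> D (t, phi s x) -> D (t + s, x) ->
    phi t (phi s x) = phi (t + s) x;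
  flow_generator : forall x, velocity A (fun t => phi t x) = xi x }.

(* The frame bundle.  A frame at x is the 1-jet at 0, i.e. the class for
   same_jet, of a locally invertible map eps : R^m -> M with eps 0 = x. *)

Definition locally_invertible (R : realType) (m : nat) (M : choiceType)
    (A : set (chart M 'cV[R]_m)) (eps : 'cV[R]_m -> M) : Prop :=
  smooth_at (@full_atlas R 'cV[R]_m) A eps 0 /\
  exists g : M -> 'cV[R]_m,
    [/\ smooth_at A (@full_atlas R 'cV[R]_m) g (eps 0),
        (\forall y \near (0 : 'cV[R]_m), g (eps y) = y) &
        exists U : set M, [/\ atlas_open A U, U (eps 0) &
          forall x, U x -> eps (g x) = x]].

Definition same_jet (R : realType) (m : nat) (M : choiceType)
    (A : set (chart M 'cV[R]_m)) (eps eps' : 'cV[R]_m -> M) : Prop :=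
  eps 0 = eps' 0 /\
  forall c, A c -> chart_dom c (eps 0) ->
    forall h : 'cV[R]_m,
      'd (fun y : 'cV[R]_m => c (eps y)) (0 : 'cV[R]_m) h =
      'd (fun y : 'cV[R]_m => c (eps' y)) (0 : 'cV[R]_m) h.

Record frame (R : realType) (m : nat) (M : choiceType)
    (A : set (chart M 'cV[R]_m)) := Frame {
  jet_class :> set ('cV[R]_m -> M);
  jet_classP : exists2 eps, locally_invertible A eps &
    jet_class = [set eps' | locally_invertible A eps' /\
                            same_jet A eps eps'] }.

HB.instance Definition _ (R : realType) (m : nat) (M : choiceType)
  (A : set (chart M 'cV[R]_m)) := gen_eqMixin (frame A).
HB.instance Definition _ (R : realType) (m : nat) (M : choiceType)
  (A : set (chart M 'cV[R]_m)) := gen_choiceMixin (frame A).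

Definition frame_rep (R : realType) (m : nat) (M : choiceType)
    (A : set (chart M 'cV[R]_m)) (u : frame A) : 'cV[R]_m -> M :=
  projT1 (cid2 (jet_classP u)).

Definition frame_base (R : realType) (m : nat) (M : choiceType)
    (A : set (chart M 'cV[R]_m)) (u : frame A) : M :=
  frame_rep u 0.

(* The chart of LM induced by a chart c of M sends j^1_0 eps to the value
   and the Jacobian matrix of c o eps at 0. *)
Definition frame_chart (R : realType) (m : nat) (M : choiceType)
    (A : set (chart M 'cV[R]_m)) (c : chart M 'cV[R]_m) :
    chart (frame A) ('cV[R]_m * 'M[R]_m)%type :=
  @Chart R (frame A) ('cV[R]_m * 'M[R]_m)%type
    [set u | chart_dom c (frame_base u)]
    (fun u => (c (frame_base u),
       \matrix_(i, j)
         ('D_(delta_mx j 0 : 'cV[R]_m)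
            (fun y : 'cV[R]_m => c (frame_rep u y)) (0 : 'cV[R]_m)) i 0)).

Definition frame_atlas (R : realType) (m : nat) (M : choiceType)
    (A : set (chart M 'cV[R]_m)) :
    set (chart (frame A) ('cV[R]_m * 'M[R]_m)%type) :=
  @frame_chart R m M A @` A.
Arguments frame_atlas {R m M} A.

(* Right action of GL(m, R): j^1_0 eps . a = j^1_0 (eps o a).  Since frames
   are classes, u eps means u = j^1_0 eps. *)
Definition frame_act (R : realType) (m : nat) (M : choiceType)
    (A : set (chart M 'cV[R]_m)) (u : frame A) (a : 'M[R]_m) : frame A :=
  xget u [set v : frame A |
    exists2 eps, jet_class u eps & jet_class v (fun y => eps (a *m y))].

(* L^1 phi : j^1_0 eps |-> j^1_0 (phi o eps), meaningful at the frames u such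
   that phi is a diffeomorphism near the base point of u. *)
Definition frame_lift (R : realType) (m : nat) (M : choiceType)
    (A : set (chart M 'cV[R]_m)) (phi : M -> M) (u : frame A) : frame A :=
  xget u [set v : frame A |
    exists2 eps, jet_class u eps & jet_class v (fun y => phi (eps y))].

(* The natural lift L xi of the vector field xi with flow phi. *)
Definition natural_lift (R : realType) (m : nat) (M : choiceType)
    (A : set (chart M 'cV[R]_m)) (phi : R -> M -> M) (u : frame A) :
    tvec (frame A) ('cV[R]_m * 'M[R]_m)%type :=
  velocity (frame_atlas A) (fun t => frame_lift (phi t) u).

(* Lie subgroups of GL(m, R), as immersed submanifolds. *)

Definition GL_atlas (R : realType) (m : nat) :
    set (chart 'M[R]_m 'M[R]_m) :=
  [set @Chart R 'M[R]_m 'M[R]_m [set a | a \in unitmx] id].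

Record lie_subgroup (R : realType) (m k : nat) (G : set 'M[R]_m)
    (AG : set (chart 'M[R]_m 'cV[R]_k)) : Prop := {
  lie_subgroup_unit : forall a, G a -> a \in unitmx;
  lie_subgroup_one : G 1%:M;
  lie_subgroup_mul : forall a b, G a -> G b -> G (a *m b);
  lie_subgroup_inv : forall a, G a -> G (invmx a);
  lie_subgroup_manifold : is_manifold G AG;
  lie_subgroup_smooth_mul : forall a b, G a -> G b ->
    smooth_at (prod_atlas AG AG) AG
      (fun z : 'M[R]_m * 'M[R]_m => z.1 *m z.2) (a, b);
  lie_subgroup_smooth_inv : forall a, G a ->
    smooth_at AG AG (fun b : 'M[R]_m => invmx b) a;
  lie_subgroup_immersion : forall a, G a ->
    immersion_at AG (@GL_atlas R m) id a }.

Definition lie_algebra (R : realType) (m k : nat)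
    (AG : set (chart 'M[R]_m 'cV[R]_k)) : set 'M[R]_m :=
  [set X | exists gamma : R^o -> 'M[R]_m,
     [/\ smooth_at (@full_atlas R R^o) AG gamma 0, gamma 0 = 1%:M &
         derive1 gamma 0 = X]].

(* gl(m, R) is the direct sum of the Lie algebra of G and of mm, and mm is
   stable under Ad_a for all a in G. *)
Definition reductive_complement (R : realType) (m k : nat)
    (G : set 'M[R]_m) (AG : set (chart 'M[R]_m 'cV[R]_k))
    (mm : {vspace 'M[R]_m}) : Prop :=
  [/\ (forall X : 'M[R]_m, exists Y Z : 'M[R]_m,
         [/\ lie_algebra AG Y, Z \in mm & X = Y + Z]),
      (forall X : 'M[R]_m, lie_algebra AG X -> X \in mm -> X = 0) &
      (forall a X : 'M[R]_m, G a -> X \in mm -> a *m X *m invmx a \in mm)].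

(* u |-> (frame_base u, theta u) is a G-equivariant diffeomorphism from the
   part of P over U onto U x G, with inverse tau. *)
Definition local_trivialization (R : realType) (m k n : nat) (M : choiceType)
    (A : set (chart M 'cV[R]_m)) (G : set 'M[R]_m)
    (AG : set (chart 'M[R]_m 'cV[R]_k)) (P : set (frame A))
    (AP : set (chart (frame A) 'cV[R]_n)) (U : set M)
    (theta : frame A -> 'M[R]_m) (tau : M * 'M[R]_m -> frame A) : Prop :=
  (forall u, P u -> U (frame_base u) ->
     [/\ G (theta u),
         smooth_at AP AG theta u,
         tau (frame_base u, theta u) = u &
         forall a, G a -> theta (frame_act u a) = theta u *m a]) /\
  (forall x g, U x -> G g ->
     [/\ P (tau (x, g)),
         frame_base (tau (x, g)) = x,
         theta (tau (x, g)) = g &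
         smooth_at (prod_atlas A AG) AP tau (x, g)]).

(* P(M, G) is a principal subbundle of LM, with manifold structure AP. *)
Record principal_subbundle (R : realType) (m k n : nat) (M : choiceType)
    (A : set (chart M 'cV[R]_m)) (G : set 'M[R]_m)
    (AG : set (chart 'M[R]_m 'cV[R]_k)) (P : set (frame A))
    (AP : set (chart (frame A) 'cV[R]_n)) : Prop := {
  subbundle_manifold : is_manifold P AP;
  subbundle_immersion : forall u, P u ->
    immersion_at AP (frame_atlas A) id u;
  subbundle_projection : forall u, P u ->
    smooth_at AP A (@frame_base R m M A) u;
  subbundle_act : forall u a, P u -> G a -> P (frame_act u a);
  subbundle_smooth_act : forall u a, P u -> G a ->
    smooth_at (prod_atlas AP AG) AP
      (fun z : frame A * 'M[R]_m => frame_act z.1 z.2) (u, a);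
  subbundle_trivial : forall x : M, exists U theta tau,
    [/\ atlas_open A U, U x & local_trivialization G AG P AP U theta tau] }.

Definition G_invariant (R : realType) (m n : nat) (M : choiceType)
    (A : set (chart M 'cV[R]_m)) (G : set 'M[R]_m) (P : set (frame A))
    (AP : set (chart (frame A) 'cV[R]_n))
    (X : frame A -> tvec (frame A) 'cV[R]_n) : Prop :=
  forall u a, P u -> G a ->
    tangent_map AP AP (fun v => frame_act v a) u (X u) = X (frame_act u a).

Definition expmx (R : realType) (m : nat) (X : 'M[R]_m) : 'M[R]_m :=
  limn (series (fun i : nat => (i`!%:R : R)^-1 *: X ^+ i)).

(* The fibre at u of the transverse bundle M(P). *)
Definition transverse_fibre (R : realType) (m : nat) (M : choiceType)
    (A : set (chart M 'cV[R]_m)) (mm : {vspace 'M[R]_m}) (u : frame A) :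
    set (tvec (frame A) ('cV[R]_m * 'M[R]_m)%type) :=
  [set w | exists2 mu, mu \in mm &
     w = velocity (frame_atlas A) (fun t => frame_act u (expmx (t *: mu)))].

(* Smooth sections of M(P), a subbundle of the pullback of T(LM) to P. *)
Definition transverse_field (R : realType) (m n : nat) (M : choiceType)
    (A : set (chart M 'cV[R]_m)) (mm : {vspace 'M[R]_m}) (P : set (frame A))
    (AP : set (chart (frame A) 'cV[R]_n))
    (Y : frame A -> tvec (frame A) ('cV[R]_m * 'M[R]_m)%type) : Prop :=
  (forall u, P u -> transverse_fibre mm u (Y u)) /\
  (forall c u, frame_atlas A c -> P u -> chart_dom c u ->
     smooth_at AP (@full_atlas R ('cV[R]_m * 'M[R]_m)%type)
       (fun v => Y v c) u).

(* Main.v *)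
(* At u in P, local triviality and reductivity give T_u(LM) = T_uP + M_u.  For
   the existence of a decomposition of the natural lift, compare the curve
   L^1 phi_t (u) with the curve in P obtained by applying a local section of P
   to phi_t x: both lie over phi_t x, so their velocities differ by a vertical
   vector u X, and X splits along gl(m) = g + m; the g-part is tangent to P and
   the m-part is in M_u.  Conversely, a vector of T_uP that is vertical is the
   velocity of u a(t) with a a curve in G, so it meets M_u only in 0.
   Smoothness: in a chart of P the two components are the coordinates of L xi in
   a family of vectors depending smoothly on u and linearly independent at each
   point, hence they are smooth by Cramer's rule.  Invariance: L xi and the
   bundle M(P) are invariant under G (the latter by Ad-stability of m), so the
   translates of the components of L xi at u decompose L xi at u a, and
   uniqueness applies. *)
From HB Require Import structures.
Require Import Defs.
From mathcomp Require Import all_boot all_order all_algebra.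
From mathcomp Require Import all_classical all_reals all_analysis.
From mathcomp Require Import ring.

Set Implicit Arguments.
Unset Strict Implicit.
Unset Printing Implicit Defensive.

Import Order.TTheory GRing.Theory Num.Theory.
Import numFieldNormedType.Exports.

Local Open Scope classical_set_scope.
Local Open Scope ring_scope.

(** * Calculus of C^k maps *)

(** In a chart [c] of [M] a frame is a pair of a point and an invertible matrix. Changes of chart
    and Jacobians of the flow multiply this matrix on the left, the structure group on the right.
    That these commute makes the vector [X] of the overview independent of the chart and makes the
    natural lift invariant. Tangent vectors are families of chart components, so identities about
    [tangent_map] are reduced to curves: a vector is realised as a velocity and the curve is pushed
    forward. [G] and [P] carry immersed structures, whose topology may be finer than the induced
    one. A curve of frames that stays in [P] is therefore not known to be smooth for [AP]; the
    curves in [P] come from its charts, from a trivialization [tau] or from the action, and are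
    included in [LM] only afterwards. [Ck] speaks of derivatives in fixed directions, whereas the
    chain rule produces a direction that varies with the point. [findim] provides finitely many
    fixed directions along which to expand it; the vectors [e i] only have to span. *)

Class findim (R : realType) (E : normedModType R) : Prop := Findim {
  findimP : exists (I : finType) (e : I -> E) (l : I -> {linear E -> R}),
    (forall i, continuous (l i)) /\ forall x, x = \sum_i l i x *: e i }.

Section differential_congruence.
Variables (R : realType) (E F : normedModType R).

Lemma near0_diff (h : E -> F) a : (\forall x \near a, h x = 0) ->
  differentiable h a /\ 'd h a = (fun=> 0) :> (E -> F).
Proof.
move=> h0.
pose z : {linear E -> F} := \0.
have zc : continuous z by move=> x; exact: cvg_cst.
have hz : h \o shift a = cst (h a) + (z : E -> F) +o_ 0 id.
  apply/eqaddoP => eps eps0.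
  have h0' : \forall x \near (0 : E), h (x + a) = 0.
    by move: h0; rewrite (near_shift 0) /=; apply: filterS => x /=;
      rewrite subr0.
  near=> x.
  rewrite /= !fctE (nbhs_singleton h0) addr0 subr0.
  rewrite (_ : h (x + a) = 0) ?normr0 ?mulr_ge0 ?normr_ge0 ?ltW//.
  by near: x.
have dh := diff_unique zc hz.
by split=> //; apply/diff_locallyP; rewrite dh.
Unshelve. all: by end_near. Qed.

(** Writing g = f + (g - f) reduces locality of the differential to a function that vanishes near
    [a], for which the zero map is the differential by uniqueness. *)
Lemma near_eq_diff (f g : E -> F) a : (\forall x \near a, f x = g x) ->
  differentiable f a ->
  differentiable g a /\ 'd g a = 'd f a :> (E -> F).
Proof.
move=> fg df.
have [dh dh0] : differentiable (g - f) a /\ 'd (g - f) a = (fun=> 0) :> (E ->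
  F).
  by apply: near0_diff; apply: filterS fg => x fgx; rewrite !fctE fgx subrr.
have -> : g = f + (g - f) by rewrite addrC subrK.
split; first exact: differentiableD.
rewrite (diffD df dh); apply/funext => x.
have dh0x : 'd (g - f) a x = 0 by rewrite dh0.
by rewrite -[LHS]/('d f a x + 'd (g - f) a x) dh0x addr0.
Qed.

End differential_congruence.


Section Ck_calculus.
Variable R : realType.
Implicit Types (E F H : normedModType R).

Lemma Ck_ext E F k (U : set E) (f g : E -> F) : open U ->
  (forall x, U x -> f x = g x) -> Ck k U f -> Ck k U g.
Proof.
move=> oU; elim: k f g => [|k IH] f g fg.
  move=> /= fc x Ux.
  have fgn : \forall y \near x, f y = g y.
    by have := open_nbhs_nbhs (conj oU Ux); apply: filterS => y /fg.
  rewrite /prop_for /continuous_at -(fg x Ux).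
  by apply: cvg_trans (fc x Ux); apply: near_eq_cvg; apply: filterS fgn => y ->.
have fgn x : U x -> \forall y \near x, f y = g y.
  by move=> Ux; have := open_nbhs_nbhs (conj oU Ux); apply: filterS => y /fg.
move=> [fd fD]; split.
  by move=> x Ux; have [] := near_eq_diff (fgn x Ux) (fd x Ux).
move=> v; apply: IH (fD v) => x Ux.
exact: near_eq_derive (fgn x Ux).
Qed.

Lemma Ck_sub E F k (U V : set E) (f : E -> F) :
  V `<=` U -> Ck k U f -> Ck k V f.
Proof.
move=> VU; elim: k f => [|k IH] f /=; first by move=> fc x /VU /fc.
by move=> [fd fD]; split=> [x /VU /fd //|v]; apply: IH.
Qed.

Lemma Ck_continuous E F k (U : set E) (f : E -> F) x :
  Ck k U f -> U x -> {for x, continuous f}.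
Proof.
case: k => [|k] /=; first by apply.
by move=> [fd _] Ux; apply: differentiable_continuous; apply: fd.
Qed.

Lemma Ck_pred E F k (U : set E) (f : E -> F) : Ck k.+1 U f -> Ck k U f.
Proof.
elim: k f => [|k IH] f; first by move=> Cf x; exact: (Ck_continuous Cf).
by move=> [fd fD]; split=> // v; apply: IH; apply: fD.
Qed.

Lemma Ck_cst E F k (U : set E) (a : F) : Ck k U (fun _ : E => a).
Proof.
elim: k a => [|k IH] a; first by move=> x _; exact: cvg_cst.
split; first by move=> x _; exact: differentiable_cst.
move=> v; have -> : (fun x : E => 'D_v (fun=> a) x) = fun=> 0.
  by apply/funext => x; rewrite derive_cst.
exact: IH.
Qed.

Lemma CkD E F k (U : set E) (f g : E -> F) : open U ->
  Ck k U f -> Ck k U g -> Ck k U (fun x => f x + g x).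
Proof.
move=> oU; elim: k f g => [|k IH] f g.
  by move=> fc gc x Ux; apply: cvgD; [exact: fc|exact: gc].
move=> [fd fD] [gd gD]; split.
  by move=> x Ux; apply: differentiableD; [exact: fd|exact: gd].
move=> v; apply: (Ck_ext oU _ (IH _ _ (fD v) (gD v))) => x Ux.
rewrite -[RHS]/('D_v (f + g) x) deriveD //; apply: diff_derivable.
  exact: fd.
exact: gd.
Qed.

Lemma Ck_sum E F k (U : set E) (I : Type) (r : seq I) (f : I -> E -> F) :
  open U -> (forall i, Ck k U (f i)) -> Ck k U (fun x => \sum_(i <- r) f i x).
Proof.
move=> oU fC; elim: r => [|i r IH].
  by apply: (Ck_ext oU _ (Ck_cst k U 0)) => x _; rewrite big_nil.
by apply: (Ck_ext oU _ (CkD oU (fC i) IH)) => x _; rewrite big_cons.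
Qed.

Lemma diff_compE E F H (f : E -> F) (g : F -> H) x v :
  differentiable f x -> differentiable g (f x) ->
  'd (g \o f) x v = 'd g (f x) ('d f x v).
Proof. by move=> fd gd; exact: (congr1 (fun h => h v) (diff_comp fd gd)). Qed.

Lemma derive_lin E F H (L : {linear F -> H}) (f : E -> F) x v :
  continuous L -> differentiable f x ->
  'D_v (fun y => L (f y)) x = L ('D_v f x).
Proof.
move=> Lc fd.
have dL y : differentiable L y by exact: linear_differentiable.
transitivity ('d (L \o f) x v).
  by apply: deriveE; exact: differentiable_comp.
rewrite diff_compE //; transitivity (L ('d f x v)).
  exact: (congr1 (fun h => h ('d f x v)) (diff_lin (f x) Lc)).
by congr (L _); symmetry; exact: deriveE.
Qed.

Lemma Ck_lin E F H k (U : set E) (L : {linear F -> H}) (f : E -> F) :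
  open U -> continuous L -> Ck k U f -> Ck k U (fun x => L (f x)).
Proof.
move=> oU Lc; elim: k f => [|k IH] f.
  by move=> fc x Ux; apply: continuous_comp; [exact: fc|exact: Lc].
move=> [fd fD]; split.
  move=> x Ux; apply: (@differentiable_comp _ _ _ _ f L); first exact: fd.
  exact: linear_differentiable.
move=> v; apply: (Ck_ext oU _ (IH _ (fD v))) => x Ux.
by rewrite derive_lin //; exact: fd.
Qed.

Lemma Ck_pair E F H k (U : set E) (f : E -> F) (g : E -> H) : open U ->
  Ck k U f -> Ck k U g -> Ck k U (fun x => (f x, g x)).
Proof.
move=> oU; elim: k f g => [|k IH] f g.
  by move=> fc gc x Ux; apply: cvg_pair; [exact: fc|exact: gc].
move=> [fd fD] [gd gD]; split.
  by move=> x Ux; apply: differentiable_pair; [exact: fd|exact: gd].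
move=> v; apply: (Ck_ext oU _ (IH _ _ (fD v) (gD v))) => x Ux.
symmetry; transitivity ('d (fun x => (f x, g x)) x v).
  by apply: deriveE; exact: differentiable_pair (fd x Ux) (gd x Ux).
transitivity ('d f x v, 'd g x v).
  exact: (congr1 (fun h => h v) (diff_pair (fd x Ux) (gd x Ux))).
by congr pair; symmetry; apply: deriveE; [exact: fd|exact: gd].
Qed.

End Ck_calculus.

Section Ck_calculus2.
Variable R : realType.
Implicit Types (E F H : normedModType R).

Lemma scale_is_bilinear F :
  bilinear_for
    (GRing.Scale.Law.clone _ _ *:%R _) (GRing.Scale.Law.clone _ _ *:%R _)
    (@GRing.scale R F).
Proof.
split=> [u'|u] a x y /=; first by rewrite scalerDl scalerA.
by rewrite scalerDr !scalerA mulrC.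
Qed.

HB.instance Definition _ F :=
  bilinear_isBilinear.Build R R F F _ _ (@GRing.scale R F)
  (@scale_is_bilinear F).

Lemma scale_pair_continuous F : continuous (fun p : R * F => p.1 *: p.2).
Proof. by move=> p; apply: cvgZ; [exact: cvg_fst|exact: cvg_snd]. Qed.

Lemma differentiable_scale E F (a : E -> R) (f : E -> F) x :
  differentiable a x -> differentiable f x ->
  differentiable (fun y => a y *: f y) x /\
  forall v, 'd (fun y => a y *: f y) x v = a x *: 'd f x v + 'd a x v *: f x.
Proof.
move=> ad fd.
have sc := @scale_pair_continuous F.
pose s : R * F -> F := fun p => p.1 *: p.2.
have sd p : differentiable s p by exact: differentiable_bilin.
have pd := differentiable_pair ad fd.
split; first exact: (@differentiable_comp _ _ _ _ (fun y => (a y, f y)) s).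
move=> v; rewrite -[LHS]/('d (s \o (fun y => (a y, f y))) x v).
rewrite (diff_compE v pd (sd _)).
rewrite (congr1 (fun h => h v) (diff_pair ad fd)).
exact: (congr1 (fun h => h ('d a x v, 'd f x v)) (diff_bilin (a x, f x) sc)).
Qed.

Lemma CkZ E F k (U : set E) (a : E -> R) (f : E -> F) : open U ->
  Ck k U a -> Ck k U f -> Ck k U (fun x => a x *: f x).
Proof.
move=> oU; elim: k a f => [|k IH] a f.
  by move=> ac fc x Ux; apply: cvgZ; [exact: ac|exact: fc].
move=> Ca Cf; have [ad aD] := Ca; have [fd fD] := Cf; split.
  by move=> x Ux; have [] := differentiable_scale (ad x Ux) (fd x Ux).
move=> v; apply: (@Ck_ext _ _ _ _ U
    (fun x => a x *: 'D_v f x + 'D_v a x *: f x)) => //.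
  move=> x Ux; have [sd sD] := differentiable_scale (ad x Ux) (fd x Ux).
  by rewrite (deriveE v sd) sD (deriveE v (fd x Ux)) (deriveE v (ad x Ux)).
apply: CkD => //; first by apply: IH; [exact: Ck_pred Ca|exact: fD].
by apply: IH; [exact: aD|exact: Ck_pred Cf].
Qed.

(** The direction ['D_v f x] at which [g] is differentiated depends on [x]; expanding it moves this
    dependence into scalar coefficients and leaves only the fixed directions [e i]. *)
Lemma derive_findim E F H (I : finType) (e : I -> F) (l : I -> F -> R)
    (f : E -> F) (g : F -> H) x v :
  (forall y, y = \sum_i l i y *: e i) ->
  differentiable f x -> differentiable g (f x) ->
  'D_v (g \o f) x = \sum_i l i ('D_v f x) *: 'D_(e i) g (f x).
Proof.
move=> le fd gd; rewrite deriveE; last exact: differentiable_comp.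
rewrite diff_compE // [X in 'd g _ X]le linear_sum; apply: eq_bigr => i _.
by rewrite linearZ; congr (_ *: _); [rewrite deriveE|symmetry; exact: deriveE].
Qed.

(** Each term of [derive_findim] is a scalar of class C^k times the composite of [f] with the C^k
    map ['D_(e i) g], so the induction applies to the same [f] and a different [g]. *)
Lemma Ck_comp E F H {fF : findim F} k (U : set E) (W : set F)
    (f : E -> F) (g : F -> H) :
  open U -> (forall x, U x -> W (f x)) ->
  Ck k U f -> Ck k W g -> Ck k U (g \o f).
Proof.
move=> oU fUW; elim: k f g fUW => [|k IH] f g fUW.
  by move=> fc gc x Ux; apply: continuous_comp;
    [exact: fc|exact: gc (fUW _ Ux)].
move=> Cf [gd gD]; have [fd fD] := Cf; split.
  move=> x Ux; apply: differentiable_comp; first exact: fd.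
  exact: gd (fUW _ Ux).
have [r [e [l [lc le]]]] := @findimP _ _ fF.
move=> v; apply: (@Ck_ext _ _ _ _ U
    (fun x => \sum_i l i ('D_v f x) *: 'D_(e i) g (f x))) => //.
  by move=> x Ux; rewrite (derive_findim v le (fd x Ux) (gd _ (fUW x Ux))).
apply: Ck_sum => // i; apply: CkZ => //.
  by apply: Ck_lin; [exact: oU|exact: lc|exact: fD].
by apply: (IH f (fun y => 'D_(e i) g y));
  [exact: fUW|exact: Ck_pred Cf|exact: gD].
Qed.

Lemma CkM E k (U : set E) (a b : E -> R) : open U ->
  Ck k U a -> Ck k U b -> Ck k U (fun x => a x * b x).
Proof. exact: CkZ. Qed.

Lemma Ck_prod E k (U : set E) (I : Type) (r : seq I) (f : I -> E -> R) :
  open U -> (forall i, Ck k U (f i)) -> Ck k U (fun x => \prod_(i <- r) f i x).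
Proof.
move=> oU fC; elim: r => [|i r IH].
  apply: (@Ck_ext _ _ _ k U (fun _ : E => 1 : R) _ oU); last exact: Ck_cst.
  by move=> x _; rewrite big_nil.
apply: (@Ck_ext _ _ _ k U (fun x => f i x * \prod_(j <- r) f j x) _ oU).
  by move=> x _; rewrite big_cons.
exact: CkM.
Qed.

(** The induction closes because the derivative of 1/a is -(1/a)^2 times that of [a], which involves
    1/a only at the lower order. *)
Lemma Ck_inv E k (U : set E) (a : E -> R) : open U ->
  (forall x, U x -> a x != 0) -> Ck k U a -> Ck k U (fun x => (a x)^-1).
Proof.
move=> oU a0; elim: k => [|k IH].
  by move=> ac x Ux; apply: cvgV; [exact: a0|exact: ac].
move=> Ca; have [ad aD] := Ca; split.
  by move=> x Ux; apply: differentiableV; [exact: ad|exact: a0].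
have Ci := IH (Ck_pred Ca).
move=> v; apply: (@Ck_ext _ _ _ _ U
    (fun x => (-1) *: (((a x)^-1 * (a x)^-1) * 'D_v a x))) => //.
  move=> x Ux; rewrite deriveV; [|exact: a0|exact/diff_derivable/ad].
  by rewrite scaleN1r -mulNr -expr2 exprVn.
apply: CkZ; [exact: oU|exact: Ck_cst|].
apply: CkM; [exact: oU|exact: CkM|exact: aD].
Qed.

Lemma Ck_id E k (U : set E) : Ck k U (@id E).
Proof.
case: k => [|k] /=; first by move=> x _; exact: cvg_id.
split; first by move=> x _; exact: ex_diff.
move=> v; have -> : (fun x : E => 'D_v id x) = fun=> v.
  by apply/funext => x; rewrite derive_id.
exact: Ck_cst.
Qed.

End Ck_calculus2.

(** * Finite-dimensional normed modules and continuity of linear maps *)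

Section finite_dimension.
Variable R : realType.
Implicit Types (E F H : normedModType R).

Definition Linear E F (f : E -> F) (fl : linear f) : {linear E -> F} :=
  HB.pack f (GRing.isLinear.Build _ _ _ _ f fl).

Lemma sum_continuous E F (I : finType) (f : I -> E -> F) :
  (forall i, continuous (f i)) -> continuous (fun x => \sum_i f i x).
Proof.
move=> fc x; have := @Ck_sum _ E F 0 setT I (index_enum I) f openT.
by apply=> // i y _; exact: fc.
Qed.

Lemma findim_linear_continuous E F {fE : findim E} (L : {linear E -> F}) :
  continuous L.
Proof.
have [I [e [l [lc le]]]] := @findimP _ _ fE.
have -> : (L : E -> F) = fun x => \sum_i l i x *: L (e i).
  apply/funext => x; rewrite {1}(le x) linear_sum.
  by apply: eq_bigr => i _; rewrite linearZ.
by apply: sum_continuous => i x; apply: cvgZr_tmp; exact: lc.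
Qed.

Lemma mx_coord_linear m n (i : 'I_m) (j : 'I_n) :
  linear (fun A : 'M[R]_(m, n) => A i j : R).
Proof. by move=> a A B; rewrite !mxE. Qed.

Global Instance findim_matrix m n : findim 'M[R]_(m, n).
Proof.
split; exists ('I_m * 'I_n)%type, (fun p => delta_mx p.1 p.2),
  (fun p => Linear (@mx_coord_linear m n p.1 p.2)); split.
  by move=> p x; exact: coord_continuous.
move=> x; rewrite {1}(matrix_sum_delta x) pair_bigA /=.
by apply: eq_bigr => -[i j] _.
Qed.

Lemma id_linear E : linear (@id E).
Proof. by []. Qed.

Global Instance findim_real : findim (R : normedModType R).
Proof.
split; exists unit, (fun=> 1), (fun=> Linear (@id_linear R)).
split=> [_ x|x]; first exact: cvg_id.
by rewrite big_const card_unit /= addr0 [RHS]mulr1.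
Qed.

Global Instance findim_real_o : findim (R^o : normedModType R).
Proof. exact: findim_real. Qed.

Lemma fst_linear E F : linear (fun p : E * F => p.1).
Proof. by []. Qed.

Lemma snd_linear E F : linear (fun p : E * F => p.2).
Proof. by []. Qed.

Lemma inl_linear E F : linear (fun x : E => (x, 0) : E * F).
Proof. by move=> a x y; congr pair; rewrite /= scaler0 addr0. Qed.

Lemma inr_linear E F : linear (fun y : F => (0, y) : E * F).
Proof. by move=> a x y; congr pair; rewrite /= scaler0 addr0. Qed.

Lemma comp_linear E F H (K : {linear F -> H}) (L : {linear E -> F}) :
  linear (fun x => K (L x)).
Proof. by move=> a x y; rewrite !linearP. Qed.

Global Instance findim_prod E F {fE : findim E} {fF : findim F} :
  findim (E * F)%type.
Proof.
have [I [e [l [lc le]]]] := @findimP _ _ fE.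
have [J [f [k [kc kf]]]] := @findimP _ _ fF.
split; exists (I + J)%type,
  (fun s => match s with inl i => (e i, 0) | inr j => (0, f j) end),
  (fun s => match s with
    | inl i => Linear (comp_linear (l i) (Linear (@fst_linear E F)))
    | inr j => Linear (comp_linear (k j) (Linear (@snd_linear E F))) end).
split=> [[i|j] x|[x y]].
- by apply: continuous_comp; [exact: cvg_fst|exact: lc].
- by apply: continuous_comp; [exact: cvg_snd|exact: kc].
rewrite big_sumType /=.
have -> : \sum_i l i x *: ((e i, 0) : E * F) = (x, 0).
  transitivity (\sum_i Linear (@inl_linear E F) (l i x *: e i)).
    by apply: eq_bigr => i _; rewrite linearZ.
  by rewrite -linear_sum -le.
have -> : \sum_i k i y *: ((0, f i) : E * F) = (0, y).
  transitivity (\sum_i Linear (@inr_linear E F) (k i y *: f i)).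
    by apply: eq_bigr => i _; rewrite linearZ.
  by rewrite -linear_sum -kf.
by congr pair; rewrite /= ?addr0 ?add0r.
Qed.

End finite_dimension.

(** * Smooth maps on open sets, smooth matrix functions, smooth linear systems *)

Section smooth_maps.
Variable R : realType.
Implicit Types (E F H : normedModType R).

Lemma open_setI_preimage (T T' : topologicalType) (U : set T) (W : set T')
    (f : T -> T') :
  open U -> (forall x, U x -> {for x, continuous f}) -> open W ->
  open (U `&` f @^-1` W).
Proof.
move=> oU fc oW; rewrite openE => x [Ux Wfx]; apply: filterI.
  exact: open_nbhs_nbhs.
by apply: fc => //; exact: open_nbhs_nbhs.
Qed.

Lemma smooth_continuous E F (U : set E) (f : E -> F) x :
  smooth_on U f -> U x -> {for x, continuous f}.
Proof. by move=> /(_ 0%N) fc Ux; exact: fc. Qed.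

Lemma smooth_differentiable E F (U : set E) (f : E -> F) x :
  smooth_on U f -> U x -> differentiable f x.
Proof. by move=> /(_ 1%N) [fd _] Ux; exact: fd. Qed.

Lemma smooth_preimage E F (U : set E) (W : set F) (f : E -> F) :
  open U -> smooth_on U f -> open W -> open (U `&` f @^-1` W).
Proof.
by move=> oU fs; apply: open_setI_preimage => // x; exact: smooth_continuous.
Qed.

Lemma smooth_ext E F (U : set E) (f g : E -> F) : open U ->
  (forall x, U x -> f x = g x) -> smooth_on U f -> smooth_on U g.
Proof. by move=> oU fg fs k; exact: Ck_ext (fs k). Qed.

Lemma smooth_sub E F (U V : set E) (f : E -> F) :
  V `<=` U -> smooth_on U f -> smooth_on V f.
Proof. by move=> VU fs k; exact: Ck_sub (fs k). Qed.

Lemma smooth_derive E F (U : set E) (f : E -> F) v :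
  smooth_on U f -> smooth_on U (fun x => 'D_v f x).
Proof. by move=> fs k; have [_] := fs k.+1; exact. Qed.

Lemma smooth_cst E F (U : set E) (a : F) : smooth_on U (fun _ : E => a).
Proof. by move=> k; exact: Ck_cst. Qed.

Lemma smooth_id E (U : set E) : smooth_on U (@id E).
Proof. by move=> k; exact: Ck_id. Qed.

Lemma smoothD E F (U : set E) (f g : E -> F) : open U ->
  smooth_on U f -> smooth_on U g -> smooth_on U (fun x => f x + g x).
Proof. by move=> oU fs gs k; exact: CkD. Qed.

Lemma smoothZ E F (U : set E) (a : E -> R) (f : E -> F) : open U ->
  smooth_on U a -> smooth_on U f -> smooth_on U (fun x => a x *: f x).
Proof. by move=> oU fs gs k; exact: CkZ. Qed.

Lemma smoothM E (U : set E) (a b : E -> R) : open U ->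
  smooth_on U a -> smooth_on U b -> smooth_on U (fun x => a x * b x).
Proof. exact: smoothZ. Qed.

Lemma smooth_inv E (U : set E) (a : E -> R) : open U ->
  (forall x, U x -> a x != 0) -> smooth_on U a ->
  smooth_on U (fun x => (a x)^-1).
Proof. by move=> oU a0 fs k; exact: Ck_inv. Qed.

Lemma smooth_sum E F (U : set E) (I : Type) (r : seq I) (f : I -> E -> F) :
  open U -> (forall i, smooth_on U (f i)) ->
  smooth_on U (fun x => \sum_(i <- r) f i x).
Proof. by move=> oU fs k; apply: Ck_sum => // i; exact: fs. Qed.

Lemma smooth_prod E (U : set E) (I : Type) (r : seq I) (f : I -> E -> R) :
  open U -> (forall i, smooth_on U (f i)) ->
  smooth_on U (fun x => \prod_(i <- r) f i x).
Proof. by move=> oU fs k; apply: Ck_prod => // i; exact: fs. Qed.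

Lemma smooth_pair E F H (U : set E) (f : E -> F) (g : E -> H) : open U ->
  smooth_on U f -> smooth_on U g -> smooth_on U (fun x => (f x, g x)).
Proof. by move=> oU fs gs k; exact: Ck_pair. Qed.

Lemma smooth_lin E F H {fF : findim F} (U : set E) (L : {linear F -> H})
    (f : E -> F) :
  open U -> smooth_on U f -> smooth_on U (fun x => L (f x)).
Proof.
by move=> oU fs k; apply: Ck_lin => //; exact: findim_linear_continuous.
Qed.

Lemma smooth_comp E F H {fF : findim F} (U : set E) (W : set F)
    (f : E -> F) (g : F -> H) :
  open U -> (forall x, U x -> W (f x)) ->
  smooth_on U f -> smooth_on W g -> smooth_on U (fun x => g (f x)).
Proof. by move=> oU UW fs gs k; exact: (Ck_comp oU UW (fs k) (gs k)). Qed.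

Lemma smooth_mx E (U : set E) m n (f : E -> 'M[R]_(m, n)) : open U ->
  (forall i j, smooth_on U (fun x => f x i j)) -> smooth_on U f.
Proof.
move=> oU fs.
apply: (@smooth_ext _ _ _ (fun x => \sum_i \sum_j f x i j *: delta_mx i j)) =>
  //.
  by move=> x _; rewrite -matrix_sum_delta.
do 2![apply: smooth_sum => // ?]; apply: smoothZ => //; exact: smooth_cst.
Qed.

Lemma smooth_mx_coord E (U : set E) m n (f : E -> 'M[R]_(m, n)) i j : open U ->
  smooth_on U f -> smooth_on U (fun x => f x i j).
Proof. by move=> oU; exact: (smooth_lin (Linear (mx_coord_linear i j))). Qed.

Lemma smooth_mulmx E (U : set E) m n p (f : E -> 'M[R]_(m, n))
    (g : E -> 'M[R]_(n, p)) : open U ->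
  smooth_on U f -> smooth_on U g -> smooth_on U (fun x => f x *m g x).
Proof.
move=> oU fs gs; apply: smooth_mx => // i j.
apply: (@smooth_ext _ _ _ (fun x => \sum_l f x i l * g x l j)) => //.
  by move=> x _; rewrite mxE.
by apply: smooth_sum => // l; apply: smoothM => //; exact: smooth_mx_coord.
Qed.

Lemma smooth_det E (U : set E) n (f : E -> 'M[R]_n) : open U ->
  smooth_on U f -> smooth_on U (fun x => \det (f x)).
Proof.
move=> oU fs; apply: smooth_sum => // s; apply: smoothM => //.
  exact: smooth_cst.
by apply: smooth_prod => // i; exact: smooth_mx_coord.
Qed.

Lemma smooth_invmx E (U : set E) n (f : E -> 'M[R]_n) : open U ->
  (forall x, U x -> f x \in unitmx) ->
  smooth_on U f -> smooth_on U (fun x => invmx (f x)).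
Proof.
move=> oU fu fs.
apply: (@smooth_ext _ _ _ (fun x => (\det (f x))^-1 *: \adj (f x))) => //.
  by move=> x Ux; rewrite /invmx fu.
apply: smoothZ => //.
  apply: smooth_inv => //; last exact: smooth_det.
  by move=> x /fu; rewrite unitmxE unitfE.
apply: smooth_mx => // i j.
apply: (@smooth_ext _ _ _ (fun x => cofactor (f x) j i)) => //.
  by move=> x _; rewrite mxE.
apply: smoothM => //; first exact: smooth_cst.
apply: smooth_det => //; apply: smooth_mx => // k l.
apply: (@smooth_ext _ _ _ (fun x => f x (lift j k) (lift i l))) => //.
  by move=> x _; rewrite !mxE.
exact: smooth_mx_coord.
Qed.

(* Injectivity at y0 gives a constant left inverse B of the matrix of
   coordinates at y0; composing with B yields a square system whose
   determinant is nonzero near y0. *)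
Lemma smooth_solve E F {fF : findim F} (J : finType) (U : set E)
    (Phi : J -> E -> F) (w : E -> F) y0 : open U -> U y0 ->
  (forall j, smooth_on U (Phi j)) -> smooth_on U w ->
  (forall b : J -> R, \sum_j b j *: Phi j y0 = 0 -> forall j, b j = 0) ->
  exists (V : set E) (s : J -> E -> R),
    [/\ open V, V y0, V `<=` U, forall j, smooth_on V (s j) &
        forall y b, V y -> w y = \sum_j b j *: Phi j y -> forall j, b j = s j
          y].
Proof.
move=> oU Uy0 Phi_smooth ws inj.
have [I [e [l [lc le]]]] := @findimP _ _ fF.
pose crd (x : F) : 'rV[R]_#|I| := \row_q l (enum_val q) x.
have crd_lin : linear crd by move=> a x y; apply/rowP => q;
  rewrite !mxE linearP.
have crd_inj x : crd x = 0 -> x = 0.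
  move=> x0; rewrite (le x) big1 // => i _.
  have /rowP/(_ (enum_rank i)) := x0.
  by rewrite !mxE enum_rankK => ->; rewrite scale0r.
pose X y : 'M[R]_(#|J|, #|I|) :=
  \matrix_(p, q) l (enum_val q) (Phi (enum_val p) y).
have crdX y (b : J -> R) : crd (\sum_j b j *: Phi j y) = (\row_p b (enum_val
  p)) *m X y.
  apply/rowP => q; rewrite !mxE linear_sum (reindex _ (onW_bij _ (enum_val_bij
    J))) /=.
  by apply: eq_bigr => p _; rewrite !mxE linearZ.
have Xs : smooth_on U X.
  apply: smooth_mx => // p q.
  apply: (@smooth_ext _ _ _ (fun y => l (enum_val q) (Phi (enum_val p) y))) =>
    //.
    by move=> y _; rewrite mxE.
  exact: smooth_lin.
have /row_freeP[B XB] : row_free (X y0).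
  apply: inj_row_free => v vX.
  have /inj b0 : \sum_j v 0 (enum_rank j) *: Phi j y0 = 0.
    apply: crd_inj; rewrite crdX -[RHS]vX; congr (_ *m _).
    by apply/rowP => p; rewrite !mxE enum_valK.
  by apply/rowP => p; rewrite -[p]enum_valK b0 mxE.
have XBs : smooth_on U (fun y => X y *m B).
  by apply: smooth_mulmx => //; exact: smooth_cst.
pose V := U `&` (fun y => \det (X y *m B)) @^-1` [set x | x != 0].
have oV : open V.
  apply: (smooth_preimage oU (smooth_det oU XBs)); exact: open_neq.
have VU : V `<=` U by move=> y [].
have Vunit y : V y -> X y *m B \in unitmx by move=> [_ /=];
  rewrite unitmxE unitfE.
exists V, (fun j y => (crd (w y) *m B *m invmx (X y *m B)) 0 (enum_rank j)).
split=> //.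
- by split=> //=; rewrite XB det1 oner_neq0.
- move=> j; apply: smooth_mx_coord => //; apply: smooth_mulmx => //.
    apply: smooth_mulmx => //; last exact: smooth_cst.
    exact: (smooth_lin (Linear crd_lin) oV (smooth_sub VU ws)).
  by apply: smooth_invmx => //; exact: smooth_sub VU XBs.
move=> y b Vy ->  j; rewrite crdX -(mulmxA _ (X y) B) mulmxK ?Vunit //.
by rewrite mxE enum_rankK.
Qed.

End smooth_maps.

(** * Smooth maps between atlases and tangent vectors *)

Section atlas_basics.
Variable R : realType.
Implicit Types (S T : choiceType) (E F : normedModType R).

Definition inj_atlas T E (A : set (chart T E)) :=
  forall c, A c -> set_inj (chart_dom c) c.

Lemma chart_invK T E (c : chart T E) p q :
  set_inj (chart_dom c) c -> chart_dom c q -> chart_inv c p (c q) = q.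
Proof.
move=> ci cq.
have [dq eq] : [set q' | chart_dom c q' /\ c q' = c q] (chart_inv c p (c q)).
  by apply: xgetPex; exists q.
by apply: ci => //; rewrite inE.
Qed.

Lemma chart_inv_image T E (c : chart T E) p y : (c @` chart_dom c) y ->
  chart_dom c (chart_inv c p y) /\ c (chart_inv c p y) = y.
Proof.
move=> [q cq <-].
have // : [set q' | chart_dom c q' /\ c q' = c q] (chart_inv c p (c q)).
by apply: xgetPex; exists q.
Qed.

Lemma full_inj E : inj_atlas (@full_atlas R E).
Proof. by move=> _ -> x y. Qed.

Lemma full_invE E p y : chart_inv (@Chart R E E setT id) p y = y.
Proof. exact: (@chart_invK E E (@Chart R E E setT id) p y (full_inj erefl)).
  Qed.

Lemma full_support E (p : E) : Defs.support (@full_atlas R E) p.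
Proof. by exists (@Chart R E E setT id). Qed.

Lemma prod_inj S T E F (A : set (chart S E)) (B : set (chart T F)) :
  inj_atlas A -> inj_atlas B -> inj_atlas (prod_atlas A B).
Proof.
move=> iA iB _ [c [d [Ac Bd ->]]] [x y] [x' y'] /=.
rewrite !inE /= => -[/= cx dy] [/= cx' dy'] [ex ey].
by congr pair; [apply: (iA c)|apply: (iB d)]; rewrite ?inE.
Qed.

Lemma prod_chart_inv S T E F (c : chart S E) (d : chart T F) p q x y :
  set_inj (chart_dom c) c -> set_inj (chart_dom d) d ->
  (c @` chart_dom c) x -> (d @` chart_dom d) y ->
  chart_inv (@Chart R (S * T)%type (E * F)%type
    (chart_dom c `*` chart_dom d) (fun z => (c z.1, d z.2))) (p, q) (x, y) =
  (chart_inv c p x, chart_inv d q y).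
Proof.
move=> ic id [x0 cx0 <-] [y0 dy0 <-]; rewrite !chart_invK //.
apply: (@chart_invK _ _ (@Chart R (S * T)%type (E * F)%type
    (chart_dom c `*` chart_dom d) (fun z => (c z.1, d z.2))) (p, q) (x0, y0)).
  move=> [u v] [u' v']; rewrite !inE /= => -[/= cx dy] [/= cx' dy'] [ex ey].
  by congr pair; [apply: ic|apply: id]; rewrite ?inE.
by [].
Qed.

End atlas_basics.

Section smooth_at_theory.
Variable R : realType.
Implicit Types (S T W : choiceType) (E F H : normedModType R).

(** Any chart [d] of the middle atlas around [f p] serves as intermediate; its injectivity cancels
    [chart_inv d] against [d] once the open set is shrunk so that [f] stays in the domain of [d]. *)
Lemma smooth_at_comp S T W E F H {fF : findim F} (A : set (chart S E))
    (B : set (chart T F)) (C : set (chart W H)) f g p :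
  inj_atlas A -> inj_atlas B ->
  smooth_at A B f p -> smooth_at B C g (f p) ->
  smooth_at A C (fun x => g (f x)) p.
Proof.
move=> iA iB [sA sB fs] [_ sC gs]; split=> // c e Ac Ce cp egp.
have [d Bd dfp] := sB.
have [V [oV Vp Vim Vd Vs]] := fs c d Ac Bd cp dfp.
have [V' [oV' Vp' Vim' Vd' Vs']] := gs d e Bd Ce dfp egp.
have cK : chart_inv c p (c p) = p by exact: chart_invK (iA c Ac) cp.
have dK y : V y -> chart_inv d (f p) (d (f (chart_inv c p y))) =
    f (chart_inv c p y).
  by move=> Vy; exact: chart_invK (iB d Bd) (Vd y Vy).
have oW := smooth_preimage oV Vs oV'.
exists (V `&` (fun y => d (f (chart_inv c p y))) @^-1` V'); split=> //.
- by split=> //=; rewrite cK.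
- by move=> y [/Vim].
- by move=> y [Vy /= /Vd']; rewrite dK.
apply: (@smooth_ext _ _ _ _ (fun y =>
    e (g (chart_inv d (f p) (d (f (chart_inv c p y))))))) => //.
  by move=> y [Vy _]; rewrite dK.
apply: (@smooth_comp _ _ _ _ _ _ V' (fun y => d (f (chart_inv c p y)))
  (fun y => e (g (chart_inv d (f p) y)))) => //.
  by move=> y [].
by apply: smooth_sub Vs => y [].
Qed.

Lemma smooth_at_pair S T W E F H (A : set (chart S E))
    (B : set (chart T F)) (C : set (chart W H)) f g p :
  smooth_at A B f p -> smooth_at A C g p ->
  smooth_at A (prod_atlas B C) (fun x => (f x, g x)) p.
Proof.
move=> [sA sB fs] [_ sC gs]; split=> //.
  have [[d Bd dp] [e Ce ep]] := (sB, sC).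
  by exists (@Chart R (T * W)%type (F * H)%type
    (chart_dom d `*` chart_dom e) (fun z => (d z.1, e z.2))) => //; exists d, e.
move=> c _ Ac [d [e [Bd Ce ->]]] cp /= [/= dp ep].
have [V [oV Vp Vim Vd Vs]] := fs c d Ac Bd cp dp.
have [V' [oV' Vp' _ Vd' Vs']] := gs c e Ac Ce cp ep.
have oW := openI oV oV'.
exists (V `&` V'); split=> //.
- by move=> y [/Vim].
- by move=> y [/Vd ? /Vd' ?].
by apply: smooth_pair => //;
  [apply: smooth_sub Vs|apply: smooth_sub Vs'] => y [].
Qed.

Lemma smooth_at_cst S T E F (A : set (chart S E)) (B : set (chart T F)) q p :
  (forall c, A c -> open (c @` chart_dom c)) ->
  Defs.support A p -> Defs.support B q -> smooth_at A B (fun=> q) p.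
Proof.
move=> Ao sA sB; split=> // c d Ac Bd cp dq.
exists (c @` chart_dom c); split=> //; first exact: Ao.
exact: smooth_cst.
Qed.

Lemma smooth_at_full E F (V : set E) (f : E -> F) p : open V -> V p ->
  smooth_on V f -> smooth_at (@full_atlas R E) (@full_atlas R F) f p.
Proof.
move=> oV Vp fs; split; [exact: full_support|exact: full_support|].
move=> _ _ -> -> _ _; exists V; split=> //=; apply: smooth_ext fs => // y _.
by rewrite full_invE.
Qed.

Lemma smooth_at_from_full E T F (A : set (chart T F)) (f : E -> T) p c :
  smooth_at (@full_atlas R E) A f p -> A c -> chart_dom c (f p) ->
  exists V, [/\ open V, V p, forall y, V y -> chart_dom c (f y) &
               smooth_on V (fun y => c (f y))].
Proof.
move=> [_ _ fs] Ac cfp.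
have [V [oV Vp _ Vd Vs]] := fs (@Chart R E E setT id) c erefl Ac I cfp.
have e (y : E) : chart_inv (@Chart R E E setT id) p y = y by exact: full_invE.
exists V; split=> // [y Vy|]; first by rewrite -(e y); exact: Vd.
by apply: smooth_ext Vs => // y _; rewrite e.
Qed.

Section manifold.
Variables (T : choiceType) (F : normedModType R) (fF : findim F) (X : set T).
Variables (A : set (chart T F)) (hA : is_manifold X A).

Let iA : inj_atlas A := manifold_inj hA.

Lemma chart_open c : A c -> open (c @` chart_dom c).
Proof. by move=> Ac; have := manifold_overlap hA Ac Ac; rewrite setIid. Qed.

(** [smooth_at] quantifies over all charts of the target; smooth transition maps reduce this to a
    single one. *)
Lemma smooth_at_of_chart E (f : E -> T) (V : set E) p d : A d -> open V -> V p
  ->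
  (forall y, V y -> chart_dom d (f y)) -> smooth_on V (fun y => d (f y)) ->
  smooth_at (@full_atlas R E) A f p.
Proof.
move=> Ad oV Vp Vd Vs; split; first exact: full_support.
  by exists d => //; exact: Vd.
move=> _ e -> Ae _ efp.
have dfp := Vd _ Vp.
have [_ _ /(_ d (@Chart R F F setT id) Ad erefl dfp I)] :=
  manifold_transition hA Ad Ae dfp efp.
move=> [N [oN Np Nim _ Ns]].
have oI := manifold_overlap hA Ad Ae.
have oW := smooth_preimage oV Vs (openI oN oI).
have e' (y : E) : chart_inv (@Chart R E E setT id) p y = y by exact: full_invE.
exists (V `&` (fun y => d (f y)) @^-1` (N `&` (d @` (chart_dom d `&` chart_dom
  e)))).
split=> //=.
- by split=> //; split=> //; exists (f p).
- move=> y [Vy [_ [q [dq eq] dqy]]]; rewrite e'.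
  by rewrite -(iA Ad _ _ dqy) // inE //; exact: Vd.
apply: (@smooth_ext _ _ _ _ (fun y => e (chart_inv d (f p) (d (f y))))) => //.
  by move=> y [Vy _]; rewrite e' chart_invK //; [exact: iA|exact: Vd].
apply: (@smooth_comp _ _ _ _ _ _ N (fun y => d (f y))
  (fun y => e (chart_inv d (f p) y))) => //.
- by move=> y [_ []].
- by apply: smooth_sub Vs => y [].
Qed.

(** The counterpart for charts of the source: a smooth expression [W] in one chart around [p]
    becomes, in any other, [W] after a transition map. *)
Lemma smooth_at_factor H (h : T -> H) (V : set F) (W : F -> H) c p :
  A c -> chart_dom c p -> open V -> V (c p) -> smooth_on V W ->
  (forall q, chart_dom c q -> V (c q) -> h q = W (c q)) ->
  smooth_at A (@full_atlas R H) h p.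
Proof.
move=> Ac cp oV Vp Ws hW; split; [by exists c|exact: full_support|].
move=> d _ Ad -> dp _.
have [_ _ /(_ d (@Chart R F F setT id) Ad erefl dp I)] :=
  manifold_transition hA Ad Ac dp cp.
move=> [N [oN Np Nim _ Ns]].
have oI := manifold_overlap hA Ad Ac.
have oNI := openI oN oI.
have Ns' : smooth_on (N `&` (d @` (chart_dom d `&` chart_dom c)))
    (fun y => c (chart_inv d p y)).
  by apply: smooth_sub Ns => y [].
have oW := smooth_preimage oNI Ns' oV.
exists ((N `&` (d @` (chart_dom d `&` chart_dom c))) `&`
  (fun y => c (chart_inv d p y)) @^-1` V); split=> //=.
- split; last by rewrite /= (chart_invK _ (iA Ad) dp).
  by split=> //; exists p.
- by move=> y [[/Nim]].
apply: (@smooth_ext _ _ _ _ (fun y => W (c (chart_inv d p y)))) => //.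
  move=> y [[_ [q [dq cq] <-]]] /=; rewrite (chart_invK _ (iA Ad) dq) => Vq.
  by rewrite hW.
apply: (@smooth_comp _ _ _ _ _ _ V (fun y => c (chart_inv d p y)) W) => //.
  by move=> y [].
by apply: smooth_sub Ns' => y [].
Qed.

(** Openness for the atlas has to be tested in every chart [d]; there the set is, near each of its
    points, the preimage of [V] under the continuous transition map on the open overlap. *)
Lemma chart_atlas_open c (V : set F) : A c -> open V ->
  atlas_open A (chart_dom c `&` c @^-1` V).
Proof.
move=> Ac oV; split=> [p [cp _]|d Ad]; first by exists c.
rewrite openE => _ [p [dp [cp /= Vp]] <-].
have [_ _ /(_ d (@Chart R F F setT id) Ad erefl dp I)] :=
  manifold_transition hA Ad Ac dp cp.
move=> [N [oN Np Nim _ Ns]].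
have oI := manifold_overlap hA Ad Ac.
have oW := openI oI (smooth_preimage oN Ns oV).
apply: (@filterS _ _ _ ((d @` (chart_dom d `&` chart_dom c)) `&`
   (N `&` (fun y => c (chart_inv d p y)) @^-1` V))).
  move=> _ [[q [dq cq] <-] [_ /=]]; rewrite (chart_invK _ (iA Ad) dq) => Vq.
  by exists q.
apply: open_nbhs_nbhs; split=> //; split; first by exists p.
by split=> //=; rewrite (chart_invK _ (iA Ad) dp).
Qed.

Lemma atlas_open_near E (f : E -> T) p (U : set T) :
  smooth_at (@full_atlas R E) A f p -> atlas_open A U -> U (f p) ->
  exists V, [/\ open V, V p & forall y, V y -> U (f y)].
Proof.
move=> fs [_ Uo] Ufp; have [_ [c Ac cfp] _] := fs.
have [V [oV Vp Vd Vs]] := smooth_at_from_full fs Ac cfp.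
exists (V `&` (fun y => c (f y)) @^-1` (c @` (chart_dom c `&` U))); split.
- exact: smooth_preimage (Uo c Ac).
- by split=> //; exists (f p).
move=> y [Vy [q [cq Uq] /(iA Ac) e]].
by rewrite -e // inE //; exact: Vd.
Qed.

End manifold.

End smooth_at_theory.

(** * Tangent vectors as velocities of curves *)

Section tangent_theory.
Variable R : realType.
Implicit Types (S T : choiceType) (E F : normedModType R).

(** Smoothness at 0 means smoothness on a neighbourhood of 0; the curve is a total function whose
    values far from 0 are unconstrained. *)
Definition smooth_curve T E (A : set (chart T E)) (g : R -> T) :=
  smooth_at (@full_atlas R R^o) A (g : R^o -> T) 0.

Lemma curve_chart T E (A : set (chart T E)) g c :
  smooth_curve A g -> A c -> chart_dom c (g 0) ->
  exists V : set R^o, [/\ open V, V 0, forall t, V t -> chart_dom c (g t) &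
               smooth_on V ((fun t => c (g t)) : R^o -> E)].
Proof. exact: smooth_at_from_full. Qed.

Lemma curve_diff T E (A : set (chart T E)) g c :
  smooth_curve A g -> A c -> chart_dom c (g 0) ->
  differentiable ((fun t => c (g t)) : R^o -> E) 0.
Proof.
move=> gs Ac cg; have [V [oV V0 _ Vs]] := curve_chart gs Ac cg.
exact: smooth_differentiable Vs V0.
Qed.

Lemma curve_near T E (A : set (chart T E)) g c :
  smooth_curve A g -> A c -> chart_dom c (g 0) ->
  \forall t \near (0 : R^o), chart_dom c (g t).
Proof.
move=> gs Ac cg; have [V [oV V0 Vd _]] := curve_chart gs Ac cg.
by apply: filterS (open_nbhs_nbhs (conj oV V0)).
Qed.

Lemma velocity_out T E (A : set (chart T E)) (g : R -> T) c :
  ~ (A c /\ chart_dom c (g 0)) -> velocity A g c = 0.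
Proof. by move=> n; rewrite /velocity; case: asboolP. Qed.

Lemma velocityE T E (A : set (chart T E)) (g : R -> T) c :
  A c -> chart_dom c (g 0) ->
  velocity A g c = 'D_1 ((fun t => c (g t)) : R^o -> E) 0.
Proof.
by move=> Ac cg; rewrite /velocity asboolT // derive1E.
Qed.

Lemma velocity_diff T E (A : set (chart T E)) (g : R -> T) c :
  smooth_curve A g -> A c -> chart_dom c (g 0) ->
  velocity A g c = 'd ((fun t => c (g t)) : R^o -> E) 0 1.
Proof.
move=> gs Ac cg; rewrite velocityE //.
by apply: deriveE; exact: curve_diff gs Ac cg.
Qed.

Lemma velocity_near T E (A : set (chart T E)) (g h : R -> T) :
  (\forall t \near (0 : R^o), g t = h t) -> velocity A g = velocity A h.
Proof.
move=> gh; have g0 : g 0 = h 0 := nbhs_singleton gh.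
apply/funext => c; have [[Ac cg]|n] := pselect (A c /\ chart_dom c (g 0)).
  rewrite !velocityE -?g0 //; apply: near_eq_derive.
  by apply: filterS gh => t ->.
by rewrite !velocity_out -?g0.
Qed.

Lemma velocity_comp S T E F (A : set (chart S E))
    (B : set (chart T F)) (f : S -> T) (g : R -> S) c d :
  inj_atlas A -> smooth_curve A g -> smooth_at A B f (g 0) ->
  A c -> chart_dom c (g 0) -> B d -> chart_dom d (f (g 0)) ->
  velocity B (fun t => f (g t)) d =
  'd (fun y => d (f (chart_inv c (g 0) y))) (c (g 0)) (velocity A g c).
Proof.
move=> iA gs [_ _ fs] Ac cg Bd dfg.
have [V [oV Vg Vim Vd Vs]] := fs c d Ac Bd cg dfg.
have gd := curve_diff gs Ac cg.
rewrite (velocity_diff gs Ac cg) -diff_compE //;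
  last exact: smooth_differentiable Vs Vg.
rewrite velocityE // -deriveE; last first.
  by apply: differentiable_comp => //; exact: smooth_differentiable Vs Vg.
apply: near_eq_derive; apply: filterS (curve_near gs Ac cg) => t cgt /=.
by rewrite (chart_invK _ (iA c Ac) cgt).
Qed.

Lemma tangent_map_out S T E F (A : set (chart S E)) (B : set (chart T F))
    (f : S -> T) p v d :
  ~ (B d /\ chart_dom d (f p)) -> tangent_map A B f p v d = 0.
Proof. by move=> n; apply: xgetPN => w [Bd dfp _]; apply: n. Qed.

(** The set from which [tangent_map] picks a component is a singleton: by the chain rule each
    candidate equals the velocity of the image curve, and this no longer mentions the chart [c]. *)
Lemma tangent_map_velocity S T E F (A : set (chart S E))
    (B : set (chart T F)) (f : S -> T) (g : R -> S) :
  inj_atlas A -> smooth_curve A g -> smooth_at A B f (g 0) ->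
  tangent_map A B f (g 0) (velocity A g) = velocity B (fun t => f (g t)).
Proof.
move=> iA gs fs; apply/funext => d.
have [[Bd dfg]|n] := pselect (B d /\ chart_dom d (f (g 0))); last first.
  by rewrite tangent_map_out // velocity_out.
apply: xget_subset1.
  split=> //; have [[c Ac cg] _ _] := fs; exists c; split=> //.
  exact: velocity_comp.
move=> w w' [_ _ [c [Ac cg ->]]] [_ _ [c' [Ac' cg' ->]]].
by rewrite -!(velocity_comp iA gs fs).
Qed.

Lemma scalel_linear E (h : E) : linear (fun t : R^o => t *: h).
Proof. by move=> a s t; rewrite scalerDl scalerA. Qed.

Lemma derive_line E (x h : E) :
  'D_1 ((fun t => x + t *: h) : R^o -> E) 0 = h.
Proof.
pose L := Linear (@scalel_linear E h).
have Lc : continuous L by exact: findim_linear_continuous.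
have Ld : differentiable L (0 : R^o) by exact: linear_differentiable.
have -> : (fun t => x + t *: h) = cst x + (L : R^o -> E) by [].
rewrite deriveD; [|exact: derivable_cst|exact: diff_derivable].
rewrite derive_cst add0r deriveE //.
transitivity (L (1 : R^o)); last exact: scale1r.
exact: (congr1 (fun k => k (1 : R^o)) (diff_lin (0 : R^o) Lc)).
Qed.

Section manifold.
Variables (T : choiceType) (F : normedModType R) (fF : findim F) (X : set T).
Variables (A : set (chart T F)) (hA : is_manifold X A).

Let iA : inj_atlas A := manifold_inj hA.

Lemma smooth_at_id p : Defs.support A p -> smooth_at A A id p.
Proof.
move=> sp; split=> // c d Ac Ad cp dp.
have [_ _ /(_ c (@Chart R F F setT id) Ac erefl cp I)] :=
  manifold_transition hA Ac Ad cp dp.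
move=> [N [oN Np Nim _ Ns]].
have oI := manifold_overlap hA Ac Ad.
have oW := openI oN oI.
exists (N `&` (c @` (chart_dom c `&` chart_dom d))); split=> //.
- by split=> //; exists p.
- by move=> y [/Nim].
- by move=> _ [_ [q [cq dq] <-]]; rewrite /= (chart_invK _ (iA Ac) cq).
- by apply: smooth_sub Ns => y [].
Qed.

Lemma velocity_tangent g :
  smooth_curve A g -> is_tangent A (g 0) (velocity A g).
Proof.
move=> gs; split=> [c n|c d Ac Ad cg dg]; first exact: velocity_out.
apply: (@velocity_comp T T F F A A id g c d) => //.
by apply: smooth_at_id; exists c.
Qed.

Lemma tangent_eq p v w c : is_tangent A p v -> is_tangent A p w ->
  A c -> chart_dom c p -> v c = w c -> v = w.
Proof.
move=> [v0 vt] [w0 wt] Ac cp vw; apply/funext => d.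
have [[Ad dp]|n] := pselect (A d /\ chart_dom d p); last by rewrite v0 // w0.
by rewrite (vt c d) // (wt c d) // vw.
Qed.

Lemma curve_of_vector p c (h : F) : A c -> chart_dom c p ->
  exists g : R -> T, [/\ g 0 = p, smooth_curve A g & velocity A g c = h].
Proof.
move=> Ac cp.
pose g (t : R^o) := chart_inv c p (c p + t *: h).
have oV := chart_open hA Ac.
have g0 : g 0 = p by rewrite /g scale0r addr0 (chart_invK _ (iA Ac) cp).
pose f (t : R^o) := c p + t *: h.
have fs : smooth_on [set: R^o] f.
  by apply: smoothD; [exact: openT|exact: smooth_cst|apply: smoothZ;
    [exact: openT|exact: smooth_id|exact: smooth_cst]].
have oU := smooth_preimage openT fs oV.
set U := _ `&` _ in oU.
have U0 : U 0 by split=> //=; rewrite /f scale0r addr0; exists p.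
have Uc t : U t -> chart_dom c (g t) /\ c (g t) = f t.
  by move=> [_ /chart_inv_image]; exact.
have gs : smooth_curve A g.
  apply: (smooth_at_of_chart fF hA Ac oU U0) => [t /Uc[]//|].
  apply: smooth_ext (smooth_sub _ fs) => // [t /Uc[]//].
exists g; split=> //; rewrite velocityE ?g0 //.
transitivity ('D_1 f 0).
  apply: near_eq_derive; apply: filterS (open_nbhs_nbhs (conj oU U0)) => t.
  by move=> /Uc[].
exact: derive_line.
Qed.

(** A straight segment in one chart has the prescribed component there, and one component determines
    a tangent vector. *)
Lemma tangent_velocity p v : Defs.support A p -> is_tangent A p v ->
  exists g : R -> T, [/\ g 0 = p, smooth_curve A g & velocity A g = v].
Proof.
move=> [c Ac cp] vt; have [g [g0 gs gv]] := curve_of_vector (v c) Ac cp.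
exists g; split=> //; apply: tangent_eq vt Ac cp gv.
by rewrite -g0; exact: velocity_tangent.
Qed.

Lemma tangent_lin p a v w : is_tangent A p v -> is_tangent A p w ->
  is_tangent A p (fun c => a *: v c + w c).
Proof.
move=> [v0 vt] [w0 wt]; split=> [c n|c d Ac Ad cp dp].
  by rewrite v0 // w0 // scaler0 addr0.
by rewrite linearP -(vt c d) // -(wt c d).
Qed.

Lemma tangent0 p : is_tangent A p (fun=> 0).
Proof. by split=> // c d *; rewrite linear0. Qed.

Lemma tangent_mapE S H (B : set (chart S H)) f p v c d :
  smooth_at A B f p -> is_tangent A p v ->
  A c -> chart_dom c p -> B d -> chart_dom d (f p) ->
  tangent_map A B f p v d =
  'd (fun y => d (f (chart_inv c p y))) (c p) (v c).
Proof.
move=> fs vt Ac cp Bd dfp; have sp : Defs.support A p by exists c.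
have [g [g0 gs gv]] := tangent_velocity sp vt.
rewrite -gv; rewrite -g0 in cp fs dfp *.
by rewrite tangent_map_velocity // (velocity_comp iA gs fs Ac cp).
Qed.

Lemma tangent_map_lin S H (B : set (chart S H)) f p a v w :
  smooth_at A B f p -> is_tangent A p v -> is_tangent A p w ->
  tangent_map A B f p (fun c => a *: v c + w c) =
  (fun d => a *: tangent_map A B f p v d + tangent_map A B f p w d).
Proof.
move=> fs vt wt; apply/funext => d.
have [[Bd dfp]|n] := pselect (B d /\ chart_dom d (f p)); last first.
  by rewrite !tangent_map_out // scaler0 addr0.
have [[c Ac cp] _ _] := fs.
rewrite !(tangent_mapE fs _ Ac cp Bd dfp) //; first by rewrite linearP.
exact: tangent_lin.
Qed.

End manifold.

Lemma tangent_map_tangent S T E F {fE : findim E}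
    (X : set S) (Y : set T) (A : set (chart S E)) (B : set (chart T F)) f p v :
  is_manifold X A -> is_manifold Y B -> smooth_at A B f p ->
  is_tangent A p v -> is_tangent B (f p) (tangent_map A B f p v).
Proof.
move=> hA hB fs vt; have [sp _ _] := fs.
have [g [g0 gs gv]] := tangent_velocity fE hA sp vt.
have iA := manifold_inj hA.
rewrite -gv; rewrite -g0 in fs *; rewrite tangent_map_velocity //.
have fgs : smooth_curve B (fun t => f (g t)).
  exact: (smooth_at_comp (@full_inj R _) iA gs fs).
exact: (velocity_tangent hB fgs).
Qed.

End tangent_theory.

(** * The frame bundle in charts *)

Section jacobian_matrix.
Variables (R : realType) (m : nat).
Implicit Types (f g : 'cV[R]_m -> 'cV[R]_m).

(** Same formula as the second component of [frame_chart], so that frame matrices become instances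
    of [jac]. *)
Definition jac f (x : 'cV[R]_m) : 'M[R]_m :=
  \matrix_(i, j) ('D_(delta_mx j 0 : 'cV[R]_m) f x) i 0.

Lemma jacE f x h : differentiable f x -> 'd f x h = jac f x *m h.
Proof.
move=> fd; apply/colP => i; rewrite mxE [X in 'd f x X](matrix_sum_delta h).
rewrite linear_sum summxE; apply: eq_bigr => j _.
by rewrite big_ord1 linearZ /= !mxE mulrC deriveE.
Qed.

Lemma jac_ext f g x : (\forall y \near x, f y = g y) -> jac f x = jac g x.
Proof. by move=> fg; apply/matrixP => i j;
  rewrite !mxE (near_eq_derive _ fg). Qed.

Lemma jac_linear (a : 'M[R]_m) f x : differentiable f x ->
  (forall h, 'd f x h = a *m h) -> jac f x = a.
Proof.
move=> fd fa; apply/matrixP => i j; rewrite mxE deriveE // fa mxE.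
rewrite (bigD1 j) //= big1 ?addr0 ?mxE ?eqxx ?mulr1 // => k kj.
by rewrite mxE (negbTE kj) mulr0.
Qed.

Lemma jac_comp f g x : differentiable f x -> differentiable g (f x) ->
  jac (fun y => g (f y)) x = jac g (f x) *m jac f x.
Proof.
move=> fd gd; apply: jac_linear; first exact: differentiable_comp.
by move=> h; rewrite (diff_compE h fd gd) !jacE // mulmxA.
Qed.

Lemma mulmx_linear (a : 'M[R]_m) : linear (fun y : 'cV[R]_m => a *m y).
Proof. by move=> k x y; rewrite linearP. Qed.

Lemma smooth_mulmx_left (a : 'M[R]_m) (U : set 'cV[R]_m) : open U ->
  smooth_on U (fun y => a *m y).
Proof.
by move=> oU; apply: smooth_mulmx => //; [exact: smooth_cst|exact: smooth_id].
Qed.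

Lemma jac_mulmx (a : 'M[R]_m) x : jac (fun y => a *m y) x = a.
Proof.
have fc : continuous (Linear (mulmx_linear a)).
  exact: findim_linear_continuous.
apply: jac_linear.
  exact: (smooth_differentiable (smooth_mulmx_left a openT) I).
by move=> h; exact: (congr1 (fun k => k h) (diff_lin x fc)).
Qed.

Lemma jac_id x : jac id x = 1%:M.
Proof.
rewrite -[RHS](jac_mulmx 1%:M x); congr (jac _ x).
by apply/funext => y; rewrite mul1mx.
Qed.

End jacobian_matrix.

(** * Frames as jet classes: charts, right action and lift of maps *)

Section frames.
Variables (R : realType) (m : nat) (M : choiceType).
Variables (A : set (chart M 'cV[R]_m)) (hM : is_manifold [set: M] A).
Implicit Types (u v : frame A) (c d : chart M 'cV[R]_m).

Let iA : inj_atlas A := manifold_inj hM.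

Definition local_rep (f : M -> M) c d p :=
  fun y => d (f (chart_inv c p y)).

Lemma chart_diff (f : 'cV[R]_m -> M) c : smooth_at (@full_atlas R _) A f 0 ->
  A c -> chart_dom c (f 0) -> differentiable (fun y => c (f y)) 0.
Proof.
move=> fs Ac cf; have [V [oV V0 Vd Vs]] := smooth_at_from_full fs Ac cf.
exact: smooth_differentiable Vs V0.
Qed.

Lemma chart_near (f : 'cV[R]_m -> M) c : smooth_at (@full_atlas R _) A f 0 ->
  A c -> chart_dom c (f 0) ->
  \forall y \near (0 : 'cV[R]_m), chart_dom c (f y).
Proof.
move=> fs Ac cf; have [V [oV V0 Vd Vs]] := smooth_at_from_full fs Ac cf.
by apply: filterS (open_nbhs_nbhs (conj oV V0)).
Qed.

Lemma local_rep_diff f c d p : smooth_at A A f p -> A c -> A d ->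
  chart_dom c p -> chart_dom d (f p) ->
  differentiable (local_rep f c d p) (c p).
Proof.
move=> [_ _ fs] Ac Ad cp dfp; have [V [oV Vp _ _ Vs]] := fs c d Ac Ad cp dfp.
exact: smooth_differentiable Vs Vp.
Qed.

Lemma jac_chart_comp f (e : 'cV[R]_m -> M) c d :
  smooth_at (@full_atlas R _) A e 0 -> smooth_at A A f (e 0) ->
  A c -> A d -> chart_dom c (e 0) -> chart_dom d (f (e 0)) ->
  jac (fun y => d (f (e y))) 0 =
  jac (local_rep f c d (e 0)) (c (e 0)) *m jac (fun y => c (e y)) 0.
Proof.
move=> es fs Ac Ad ce dfe; rewrite -jac_comp; last 2 first.
- exact: chart_diff es Ac ce.
- exact: local_rep_diff.
apply: jac_ext; apply: filterS (chart_near es Ac ce) => y cy.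
by rewrite /local_rep (chart_invK _ (iA Ac) cy).
Qed.

(** Differentiating the identity that [g] after [eps] satisfies near 0 gives a left inverse of the
    Jacobian, which suffices for a square matrix. *)
Lemma locally_invertible_unit eps c : locally_invertible A eps ->
  A c -> chart_dom c (eps 0) -> jac (fun y => c (eps y)) 0 \in unitmx.
Proof.
move=> [es [g [[_ _ gs] ge _]]] Ac ce.
have [V [oV V0 _ _ Vs]] := gs c (@Chart R _ _ setT id) Ac erefl ce I.
have gd := smooth_differentiable Vs V0.
have := jac_comp (chart_diff es Ac ce) gd.
have -> : jac (fun y => g (chart_inv c (eps 0) (c (eps y)))) 0 = 1%:M.
  rewrite -[RHS](jac_id 0); apply: jac_ext.
  apply: filterS2 (chart_near es Ac ce) ge => y cy gy.
  by rewrite (chart_invK _ (iA Ac) cy).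
by move/esym/mulmx1_unit => [].
Qed.

Lemma same_jet_sym eps eps' : same_jet A eps eps' -> same_jet A eps' eps.
Proof.
move=> [e0 ed]; split; first by [].
move=> c Ac ce h.
have ce' : chart_dom c (eps 0) by rewrite e0.
have E := ed c Ac ce' h.
symmetry.
exact: E.
Qed.

Lemma same_jet_trans e1 e2 e3 :
  same_jet A e1 e2 -> same_jet A e2 e3 -> same_jet A e1 e3.
Proof.
move=> [e0 ed] [f0 fd]; split=> [|c Ac ce h]; first by rewrite e0.
have ce' : chart_dom c (e2 0) by rewrite -e0.
have E1 := ed c Ac ce h.
have E2 := fd c Ac ce' h.
exact: (etrans E1 E2).
Qed.

Lemma frame_mem u eps : jet_class u eps ->
  locally_invertible A eps /\
  jet_class u = [set eps' | locally_invertible A eps' /\ same_jet A eps eps'].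
Proof.
have [e ei ->] := jet_classP u; move=> [epsi ej]; split; first exact: epsi.
apply/seteqP; split=> e' [e'i e'j]; split; [exact: e'i| |exact: e'i|].
  exact: same_jet_trans (same_jet_sym ej) e'j.
exact: same_jet_trans ej e'j.
Qed.

(** A jet class is determined by any of its members, and the proof stored in a frame is irrelevant,
    so a common member forces Leibniz equality. *)
Lemma frame_eq u v eps : jet_class u eps -> jet_class v eps -> u = v.
Proof.
move=> /frame_mem[_ ue] /frame_mem[_ ve].
case: u v ue ve => [cu pu] [cv pv] /= eu ev.
have e : cu = cv by rewrite eu ev.
by case: cv / e pv ev => pv _; rewrite (Prop_irrelevance pu pv).
Qed.

Lemma frame_exists eps : locally_invertible A eps ->
  exists u : frame A, jet_class u eps.
Proof.
move=> ei.
have p : exists2 e, locally_invertible A e &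
    [set eps' | locally_invertible A eps' /\ same_jet A eps eps'] =
    [set eps' | locally_invertible A eps' /\ same_jet A e eps'] by exists eps.
by exists (Frame p).
Qed.

Lemma frame_rep_mem u : jet_class u (frame_rep u).
Proof.
rewrite /frame_rep; case: cid2 => e ei ue /=.
by rewrite ue; split; [exact: ei|split].
Qed.

Lemma frame_baseE u eps : jet_class u eps -> frame_base u = eps 0.
Proof.
by move=> /frame_mem[_ ue]; have := frame_rep_mem u; rewrite ue => -[_ [->]].
Qed.

(** [frame_chart] is defined through the chosen [frame_rep]. Action and lift are known only through
    some member of the class, so they can be computed in charts only after this independence of the
    representative. *)
Lemma frame_chartE u eps c : jet_class u eps -> A c -> chart_dom c (eps 0) ->
  frame_chart A c u = (c (eps 0), jac (fun y => c (eps y)) 0).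
Proof.
move=> ue Ac ce; have [ei ueq] := frame_mem ue.
have := frame_rep_mem u; rewrite {1}ueq => -[ri [r0 rd]].
rewrite /frame_chart /= (frame_baseE ue); congr pair.
have cd : differentiable (fun y => c (eps y)) 0.
  by case: ei => es _; exact: chart_diff es Ac ce.
have rdc : differentiable (fun y => c (frame_rep u y)) 0.
  by rewrite r0 in ce; case: ri => rs _; exact: chart_diff rs Ac ce.
apply/matrixP => i j; rewrite !mxE (deriveE _ cd) (deriveE _ rdc).
have E := rd c Ac ce (delta_mx j 0).
exact: (congr1 (fun w : 'cV[R]_m => w i 0) (esym E)).
Qed.

Definition frame_mx c u : 'M[R]_m := (frame_chart A c u).2.

Lemma frame_mxE u eps c : jet_class u eps -> A c -> chart_dom c (eps 0) ->
  frame_mx c u = jac (fun y => c (eps y)) 0.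
Proof. by move=> ue Ac ce; rewrite /frame_mx (frame_chartE ue). Qed.

Lemma frame_mx_unit u c : A c -> chart_dom c (frame_base u) ->
  frame_mx c u \in unitmx.
Proof.
move=> Ac cu; have ue := frame_rep_mem u; rewrite (frame_mxE ue) //.
by apply: locally_invertible_unit => //; have [] := frame_mem ue.
Qed.

Lemma frame_change u c d : A c -> A d ->
  chart_dom c (frame_base u) -> chart_dom d (frame_base u) ->
  frame_mx d u =
  jac (local_rep id c d (frame_base u)) (c (frame_base u)) *m frame_mx c u.
Proof.
move=> Ac Ad cu du; have ue := frame_rep_mem u; rewrite !(frame_mxE ue) //.
apply: (jac_chart_comp (f := id)) => //.
  by have [[]] := frame_mem ue.
by apply: (smooth_at_id hM); exists c.
Qed.

Lemma locally_invertible_mulmx eps (a : 'M[R]_m) : a \in unitmx ->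
  locally_invertible A eps -> locally_invertible A (fun y => eps (a *m y)).
Proof.
move=> au [es [g [gs ge [U [oU Ue gU]]]]].
have a0 : a *m (0 : 'cV[R]_m) = 0 by rewrite mulmx0.
have as0 : smooth_at (@full_atlas R _) (@full_atlas R _) (fun y : 'cV[R]_m =>
  a *m y) 0.
  exact: (smooth_at_full openT I (smooth_mulmx_left a openT)).
split.
  by apply: (smooth_at_comp (@full_inj R _) (@full_inj R _) as0); rewrite a0.
rewrite a0; exists (fun x => invmx a *m g x); split.
- apply: (smooth_at_comp iA (@full_inj R _) gs).
  exact: (smooth_at_full openT I (smooth_mulmx_left (invmx a) openT)).
- have ac : {for 0, continuous (fun y : 'cV[R]_m => a *m y)}.
    exact: (smooth_continuous (smooth_mulmx_left a openT) I).
  have ge' : \forall y \near (0 : 'cV[R]_m), g (eps (a *m y)) = a *m y.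
    by apply: (ac (fun y => g (eps y) = y)); rewrite a0; exact: ge.
  by apply: filterS ge' => y /= ->; rewrite mulKmx.
- by exists U; split=> // x Ux; rewrite mulKVmx // gU.
Qed.

(** For an invertible matrix the set in [frame_act] is inhabited, so its default value [u] is not
    what is returned by accident; the members come from [eps] precomposed with [a]. *)
Lemma frame_act_mem u (a : 'M[R]_m) : a \in unitmx ->
  exists2 eps, jet_class u eps & jet_class (frame_act u a) (fun y => eps (a *m
    y)).
Proof.
move=> au; have ue := frame_rep_mem u.
have [ei _] := frame_mem ue.
have [v ve] := frame_exists (locally_invertible_mulmx au ei).
have : [set v : frame A | exists2 eps, jet_class u eps &
    jet_class v (fun y => eps (a *m y))] (frame_act u a).
  by apply: xgetPex; exists v; exists (frame_rep u).
by [].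
Qed.

Lemma frame_act_base u (a : 'M[R]_m) : a \in unitmx ->
  frame_base (frame_act u a) = frame_base u.
Proof.
move=> /(frame_act_mem u)[eps ue ve].
by rewrite (frame_baseE ue) (frame_baseE ve) mulmx0.
Qed.

Lemma frame_act_mx u (a : 'M[R]_m) c : a \in unitmx ->
  A c -> chart_dom c (frame_base u) ->
  frame_mx c (frame_act u a) = frame_mx c u *m a.
Proof.
move=> /(frame_act_mem u)[eps ue ve] Ac; rewrite (frame_baseE ue) => ce.
have [[es _] _] := frame_mem ue.
rewrite (frame_mxE ve) ?mulmx0 // (frame_mxE ue) //.
rewrite -[in RHS](jac_mulmx a 0) -[X in jac _ X *m _](mulmx0 _ a).
apply: (jac_comp (f := fun y => a *m y) (g := fun y => c (eps y))).
  exact: (smooth_differentiable (smooth_mulmx_left a openT) I).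
by rewrite mulmx0; exact: chart_diff.
Qed.

Lemma frame_act1 u : frame_act u 1%:M = u.
Proof.
have [eps ue ve] := frame_act_mem u (unitmx1 R m).
apply: frame_eq ve _; rewrite (_ : (fun y => _) = eps) //.
by apply/funext => y; rewrite mul1mx.
Qed.

Lemma frame_lift_mem f u eps : jet_class u eps ->
  locally_invertible A (fun y => f (eps y)) ->
  exists2 eps', jet_class u eps' & jet_class (frame_lift f u) (fun y => f
    (eps' y)).
Proof.
move=> ue ei; have [v ve] := frame_exists ei.
have : [set v : frame A | exists2 eps, jet_class u eps &
    jet_class v (fun y => f (eps y))] (frame_lift f u).
  by apply: xgetPex; exists v; exists eps.
by [].
Qed.

Lemma frame_lift_chart f u eps c d : jet_class u eps ->
  locally_invertible A (fun y => f (eps y)) ->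
  smooth_at A A f (frame_base u) -> A c -> A d ->
  chart_dom c (frame_base u) -> chart_dom d (f (frame_base u)) ->
  frame_base (frame_lift f u) = f (frame_base u) /\
  frame_mx d (frame_lift f u) =
    jac (local_rep f c d (frame_base u)) (c (frame_base u)) *m frame_mx c u.
Proof.
move=> ue0 ei fs Ac Ad cu du; have [e ue ve] := frame_lift_mem ue0 ei.
have [[es _] _] := frame_mem ue.
rewrite (frame_baseE ue) in fs cu du *; rewrite (frame_baseE ve).
rewrite (frame_mxE ve) // (frame_mxE ue) //; split=> //.
exact: jac_chart_comp.
Qed.

Lemma frame_lift_id u : frame_lift id u = u.
Proof.
have ue := frame_rep_mem u; have [ei _] := frame_mem ue.
have [e ue' ve] := frame_lift_mem (f := id) ue ei.
exact: frame_eq ve ue'.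
Qed.

End frames.

(** * Partial derivatives and the product rule for matrices *)

Section derivative_rules.
Variable R : realType.
Implicit Types (E F H : normedModType R).

(** The two difference quotients coincide for every increment. Time derivatives thus become
    directional derivatives of a map smooth in time and space jointly. *)
Lemma derive_slice1 E H (f : R^o * E -> H) t y :
  'D_1 ((fun s => f (s, y)) : R^o -> H) t = 'D_((1, 0) : R^o * E) f (t, y).
Proof.
rewrite /derive; set d := (fun h : R => _); set d' := (fun h : R => _).
suff -> : d = d' by []; apply/funext => h; rewrite /d /d' /=.
by rewrite -[h *: (1, 0) + (t, y)]/(h *: (1 : R^o) + t, h *: 0 + y) scaler0
  add0r.
Qed.

Lemma derive_slice2 E H (f : R^o * E -> H) t y v :
  'D_v (fun y => f (t, y)) y = 'D_((0, v) : R^o * E) f (t, y).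
Proof.
rewrite /derive; set d := (fun h : R => _); set d' := (fun h : R => _).
suff -> : d = d' by []; apply/funext => h; rewrite /d /d' /=.
by rewrite -[h *: (0, v) + (t, y)]/(h *: (0 : R^o) + t, h *: v + y) scaler0
  add0r.
Qed.

Lemma derive_fst E F H {fF : findim F} {fH : findim H} (f : E -> F * H) x v :
  differentiable f x -> ('D_v f x).1 = 'D_v (fun y => (f y).1) x.
Proof.
have Lc : continuous (Linear (@fst_linear R F H)).
  by apply: (@findim_linear_continuous R (F * H)%type _ _).
by move=> fd; symmetry; exact: (derive_lin v Lc fd).
Qed.

Lemma derive_snd E F H {fF : findim F} {fH : findim H} (f : E -> F * H) x v :
  differentiable f x -> ('D_v f x).2 = 'D_v (fun y => (f y).2) x.
Proof.
have Lc : continuous (Linear (@snd_linear R F H)).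
  by apply: (@findim_linear_continuous R (F * H)%type _ _).
by move=> fd; symmetry; exact: (derive_lin v Lc fd).
Qed.

Lemma mulmx_pair_continuous m n p :
  continuous (fun z : 'M[R]_(m, n) * 'M[R]_(n, p) => z.1 *m z.2).
Proof.
move=> z; apply: (@smooth_continuous _ _ _ setT (fun z : 'M[R]_(m, n) *
  'M[R]_(n, p) => z.1 *m z.2)) => //.
apply: smooth_mulmx; first exact: openT.
  exact: (smooth_lin (Linear (@fst_linear R _ _)) openT (smooth_id _)).
exact: (smooth_lin (Linear (@snd_linear R _ _)) openT (smooth_id _)).
Qed.

Lemma differentiable_mulmx E m n p (f : E -> 'M[R]_(m, n))
    (g : E -> 'M[R]_(n, p)) x :
  differentiable f x -> differentiable g x ->
  differentiable (fun y => f y *m g y) x.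
Proof.
move=> fd gd; pose s (z : 'M[R]_(m, n) * 'M[R]_(n, p)) := z.1 *m z.2.
have sd z : differentiable s z.
  exact: (differentiable_bilin _ (@mulmx_pair_continuous m n p)).
exact: (@differentiable_comp _ _ _ _ (fun y => (f y, g y)) s _
  (differentiable_pair fd gd) (sd _)).
Qed.

Lemma derive_mulmx E m n p (f : E -> 'M[R]_(m, n)) (g : E -> 'M[R]_(n, p)) x v :
  differentiable f x -> differentiable g x ->
  'D_v (fun y => f y *m g y) x = f x *m 'D_v g x + 'D_v f x *m g x.
Proof.
move=> fd gd.
pose s (z : 'M[R]_(m, n) * 'M[R]_(n, p)) := z.1 *m z.2.
have sc := @mulmx_pair_continuous m n p.
have sd z : differentiable s z by exact: differentiable_bilin.
have pd := differentiable_pair fd gd.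
have scd : differentiable (s \o (fun y => (f y, g y))) x.
  exact: differentiable_comp.
rewrite (deriveE v fd) (deriveE v gd).
apply: etrans (deriveE v scd) _; apply: etrans (diff_compE v pd (sd _)) _.
have -> : 'd (fun y => (f y, g y)) x v = ('d f x v, 'd g x v).
  exact: (congr1 (fun h => h v) (diff_pair fd gd)).
exact: (congr1 (fun h => h ('d f x v, 'd g x v)) (diff_bilin (f x, g x) sc)).
Qed.

(** Algebra behind the independence of charts: a change of chart multiplies both frame matrices on
    the left by the same Jacobian [T], which cancels in the quotient. *)
Lemma invmx_mul_cancel n p (T J : 'M[R]_n) (K : 'M[R]_(n, p)) :
  J \in unitmx -> T *m J \in unitmx ->
  invmx (T *m J) *m (T *m K) = invmx J *m K.
Proof. by move=> Ju Tu; rewrite -{1}(mulKVmx Ju K) (mulmxA T J) mulKmx. Qed.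

End derivative_rules.

(** * Velocities of curves of frames *)

Section frame_curves.
Variables (R : realType) (m : nat) (M : choiceType).
Variables (A : set (chart M 'cV[R]_m)) (hM : is_manifold [set: M] A).
Implicit Types (u v : frame A) (c d : chart M 'cV[R]_m) (g h : R -> frame A).

Let iA : inj_atlas A := manifold_inj hM.

Lemma frame_atlas_chart c : A c -> frame_atlas A (frame_chart A c).
Proof. by exists c. Qed.

Lemma frame_curve_diff g c : smooth_curve (frame_atlas A) g -> A c ->
  chart_dom c (frame_base (g 0)) ->
  differentiable ((fun t => frame_chart A c (g t)) : R^o -> _) 0.
Proof. by move=> gs Ac cg; apply: curve_diff gs (frame_atlas_chart Ac) cg. Qed.

Lemma frame_mx_diff g c : smooth_curve (frame_atlas A) g -> A c ->
  chart_dom c (frame_base (g 0)) ->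
  differentiable ((fun t => frame_mx c (g t)) : R^o -> _) 0.
Proof.
move=> gs Ac cg; have [V [oV V0 _ Vs]] :=
  curve_chart gs (frame_atlas_chart Ac) cg.
apply: smooth_differentiable V0.
exact: (smooth_lin (Linear (@snd_linear R _ _)) oV Vs).
Qed.

Lemma frame_velocityE g c : smooth_curve (frame_atlas A) g -> A c ->
  chart_dom c (frame_base (g 0)) ->
  velocity (frame_atlas A) g (frame_chart A c) =
  ('D_1 ((fun t => c (frame_base (g t))) : R^o -> _) 0,
   'D_1 ((fun t => frame_mx c (g t)) : R^o -> _) 0).
Proof.
move=> gs Ac cg; have gd := frame_curve_diff gs Ac cg.
rewrite (velocityE (frame_atlas_chart Ac)) //.
rewrite [LHS]surjective_pairing; congr pair; first exact: derive_fst.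
exact: derive_snd.
Qed.

(* Near 0 the two curves differ by the right action of
   (frame_mx c (h t))^-1 *m frame_mx c (g t), which is independent of c. *)
Lemma vertical_difference g h :
  smooth_curve (frame_atlas A) g -> smooth_curve (frame_atlas A) h ->
  g 0 = h 0 ->
  (\forall t \near (0 : R^o), frame_base (g t) = frame_base (h t)) ->
  exists X : 'M[R]_m, forall c, A c -> chart_dom c (frame_base (g 0)) ->
    velocity (frame_atlas A) g (frame_chart A c) =
    velocity (frame_atlas A) h (frame_chart A c) + (0, frame_mx c (g 0) *m X).
Proof.
move=> gs hs gh0 gh.
pose a c (t : R^o) := invmx (frame_mx c (h t)) *m frame_mx c (g t).
have [_ [_ [c0 Ac0 <-] cg0] _] := gs.
have near_dom c : A c -> chart_dom c (frame_base (g 0)) ->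
    \forall t \near (0 : R^o), chart_dom c (frame_base (g t)).
  by move=> Ac cg; exact: (curve_near gs (frame_atlas_chart Ac) cg).
exists ('D_1 (a c0) 0) => c Ac cg.
have cg0' : chart_dom c0 (frame_base (g 0)) := cg0.
have ch : chart_dom c (frame_base (h 0)) by rewrite -gh0.
have -> : 'D_1 (a c0) 0 = 'D_1 (a c) 0.
  apply: near_eq_derive.
  apply: filterS3 gh (near_dom c Ac cg) (near_dom c0 Ac0 cg0') => t e ct c0t.
  have ct' : chart_dom c (frame_base (h t)) by rewrite -e.
  have c0t' : chart_dom c0 (frame_base (h t)) by rewrite -e.
  have cu := frame_mx_unit hM Ac0 c0t'.
  have Tu := frame_mx_unit hM Ac ct'.
  rewrite (frame_change hM Ac0 Ac c0t' ct') in Tu.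
  rewrite /a (frame_change hM Ac0 Ac c0t ct) (frame_change hM Ac0 Ac c0t' ct')
    e.
  by rewrite invmx_mul_cancel.
have [V [oV V0 Vd Vs]] := curve_chart hs (frame_atlas_chart Ac) ch.
have hVs : smooth_on V ((fun t => frame_mx c (h t)) : R^o -> _).
  exact: (smooth_lin (Linear (@snd_linear R _ _)) oV Vs).
have iVs : smooth_on V ((fun t => invmx (frame_mx c (h t))) : R^o -> _).
  by apply: smooth_invmx => // t Vt; apply: frame_mx_unit => //; exact: Vd.
have gd := frame_mx_diff gs Ac cg.
have ad : differentiable (a c) 0.
  have [W [oW W0 Wd Ws]] := curve_chart gs (frame_atlas_chart Ac) cg.
  have gWs : smooth_on W ((fun t => frame_mx c (g t)) : R^o -> _).
    exact: (smooth_lin (Linear (@snd_linear R _ _)) oW Ws).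
  have oVW := openI oV oW.
  apply: (@smooth_differentiable _ _ _ (V `&` W)); last by split.
  apply: smooth_mulmx => //.
    by apply: smooth_sub iVs => t [].
  by apply: smooth_sub gWs => t [].
rewrite !frame_velocityE //; congr pair; rewrite /= ?addr0.
  by apply: near_eq_derive; apply: filterS gh => t ->.
have a0 : a c 0 = 1%:M by rewrite /a gh0 mulVmx // frame_mx_unit.
have hd := frame_mx_diff hs Ac ch.
(* Product rule for the matrix of [g] written as the matrix of [h] times [a c]: since [a c] is the
   identity at 0, the derivative of [h] appears unchanged and the rest is the vertical term. *)
have := derive_mulmx (1 : R^o) hd ad; rewrite a0 mulmx1 gh0 addrC => <-.
apply: near_eq_derive; apply: filterS (open_nbhs_nbhs (conj oV V0)) => t Vt.
by rewrite /a mulKVmx // frame_mx_unit //; exact: Vd.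
Qed.

End frame_curves.

(** * Flows and natural lifts *)

Section flows.
Variables (R : realType) (m : nat) (M : choiceType).
Variables (A : set (chart M 'cV[R]_m)) (hM : is_manifold [set: M] A).
Variables (xi : M -> tvec M 'cV[R]_m) (D : set (R^o * M)) (phi : R -> M -> M).
Hypothesis hphi : is_flow A xi D phi.
Implicit Types (u v : frame A) (c d : chart M 'cV[R]_m).

Let iA : inj_atlas A := manifold_inj hM.

Lemma flow_smooth_at t x : D (t, x) -> smooth_at A A (phi t) x.
Proof.
move=> Dtx.
have sx : Defs.support A x by have -> := manifold_support hM.
have pr : smooth_at A (prod_atlas (@full_atlas R R^o) A) (fun y => (t : R^o,
  y)) x.
  apply: smooth_at_pair; last exact: (smooth_at_id hM).
  apply: smooth_at_cst => //; first by move=> c; exact: (chart_open hM).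
  exact: full_support.
exact: (smooth_at_comp iA (prod_inj (@full_inj R _) iA) pr (flow_smooth hphi
  Dtx)).
Qed.

Section box.
Variables (c : chart M 'cV[R]_m) (x0 : M).
Hypotheses (Ac : A c) (cx0 : chart_dom c x0).

Definition flow_rep (z : R^o * 'cV[R]_m) : 'cV[R]_m :=
  c (phi z.1 (chart_inv c x0 z.2)).

(** Intersecting with the chart image of [D] keeps every point of the box inside the flow domain,
    where the group law of the flow may be used. *)
Lemma flow_rep_smooth : exists V : set (R^o * 'cV[R]_m),
  [/\ open V, V (0, c x0), smooth_on V flow_rep &
      forall t y, V (t, y) -> [/\ (c @` chart_dom c) y,
        D (t, chart_inv c x0 y) & chart_dom c (phi t (chart_inv c x0 y))]].
Proof.
pose e := @Chart R (R^o * M)%type (R^o * 'cV[R]_m)%type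
  ([set: R^o] `*` chart_dom c) (fun z => (z.1, c z.2)).
have pe : prod_atlas (@full_atlas R R^o) A e.
  by exists (@Chart R R^o R^o setT id), c.
have ex0 : chart_dom e (0, x0) by [].
have p0 : phi 0 x0 = x0 := flow_id hphi x0.
have cp0 : chart_dom c (phi 0 x0) by rewrite p0.
have [_ _ fs] := flow_smooth hphi (flow_zero hphi x0).
have [V [oV V0 Vim Vd Vs]] := fs e c pe Ac ex0 cp0.
have [_ oD] := flow_open hphi.
have einv t y : V (t, y) -> (c @` chart_dom c) y /\
    chart_inv e (0, x0) (t, y) = (t, chart_inv c x0 y).
  move=> /Vim [[s x] [_ /= cx] [<- <-]].
  have cxim : (c @` chart_dom c) (c x) by exists x.
  split=> //.
  have := prod_chart_inv (c := @Chart R R^o R^o setT id) (0 : R^o) x0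
    (x := s) (full_inj erefl) (iA Ac) _ cxim.
  rewrite full_invE; apply.
  by exists s.
have oVD := openI oV (oD e pe).
exists (V `&` (e @` (chart_dom e `&` D))); split=> //.
- by split=> //; exists (0, x0) => //; split=> //; exact: (flow_zero hphi).
- apply: (@smooth_ext _ _ _ _ (fun z => c (phi (chart_inv e (0, x0) z).1
    (chart_inv e (0, x0) z).2))) => //.
    by move=> [t y] [Vty _]; rewrite (einv t y Vty).2.
  by apply: smooth_sub Vs => z [].
move=> t y [Vty [[s x] [[_ /= cx] Dsx] [est exy]]].
have [yim ie] := einv t y Vty; split=> //.
  by rewrite -exy -est (chart_invK _ (iA Ac) cx).
by have := Vd _ Vty; rewrite ie.
Qed.

Lemma slice_open (V : set (R^o * 'cV[R]_m)) (t : R) :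
  open V -> open [set y | V (t, y)].
Proof.
move=> oV.
have -> : [set y | V (t, y)] = setT `&` (fun y : 'cV[R]_m => ((t : R^o), y))
  @^-1` V.
  by rewrite setTI.
apply: smooth_preimage oV; first exact: openT.
by apply: smooth_pair; [exact: openT|exact: smooth_cst|exact: smooth_id].
Qed.

(** Composing a locally invertible map with [phi t] calls for the local inverse [phi (- t)], but [D]
    is not assumed to contain (-t, phi t x) along with (t, x). Restricting the box to points that
    [back] sends into [V] again guarantees this near time 0. *)
Lemma flow_box : exists V : set (R^o * 'cV[R]_m),
  [/\ open V, V (0, c x0), smooth_on V flow_rep &
      forall t y, V (t, y) -> [/\ (c @` chart_dom c) y,
        chart_dom c (phi t (chart_inv c x0 y)),
        smooth_at A A (phi t) (chart_inv c x0 y) &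
        forall eps, locally_invertible A eps -> eps 0 = chart_inv c x0 y ->
          locally_invertible A (fun z => phi t (eps z))]].
Proof.
have [V [oV V0 Vs Vd]] := flow_rep_smooth.
pose back (z : R^o * 'cV[R]_m) : R^o * 'cV[R]_m := (- z.1, flow_rep z).
have bs : smooth_on V back.
  apply: smooth_pair => //; apply: (@smooth_ext _ _ _ _ (fun z : R^o *
    'cV[R]_m => -1 *: z.1)) => //.
    by move=> z _; rewrite scaleN1r.
  apply: smoothZ => //; first exact: smooth_cst.
  exact: (smooth_lin (Linear (@fst_linear R _ _)) oV (smooth_id _)).
have oW := smooth_preimage oV bs oV.
have invK x y : chart_dom c x -> c x = y -> chart_inv c x0 y = x.
  by move=> cx <-; exact: chart_invK (iA Ac) cx.
(* The third domain condition of [flow_add] is at time -t + t = 0, where [flow_zero] applies. *)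
have add0 t x : D (t, x) -> D (- t, phi t x) -> phi (- t) (phi t x) = x.
  move=> Dt Dnt; rewrite (flow_add hphi Dt Dnt) addNr ?(flow_id hphi) //.
  exact: (flow_zero hphi).
exists (V `&` back @^-1` V); split=> //.
- split=> //; rewrite /= /back /flow_rep /= oppr0 (flow_id hphi).
  by rewrite (chart_invK _ (iA Ac) cx0).
- by apply: smooth_sub Vs => z [].
move=> t y [Vty /= Vback].
have [yim Dt cphi] := Vd t y Vty.
have [_ Dnt _] := Vd _ _ Vback.
have ix : chart_inv c x0 (flow_rep (t, y)) = phi t (chart_inv c x0 y).
  exact: invK cphi erefl.
rewrite ix in Dnt.
have back_x := add0 _ _ Dt Dnt.
have fts := flow_smooth_at Dt.
split=> // eps ei e0; have [es [g [gs ge [U [oU Ue gU]]]]] := ei.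
rewrite -e0 in Dt Dnt back_x fts cphi.
have es0 : smooth_at (@full_atlas R _) A (fun z => phi t (eps z)) 0.
  exact: (smooth_at_comp (@full_inj R _) iA es fts).
split=> //.
have cx : chart_dom c (eps 0) by rewrite e0; have [] := chart_inv_image x0 yim.
have cxy : c (eps 0) = y by rewrite e0; have [] := chart_inv_image x0 yim.
exists (fun z => g (phi (- t) z)); split.
- apply: (smooth_at_comp iA iA (flow_smooth_at Dnt)).
  by rewrite back_x.
- pose W := [set y' | (V `&` back @^-1` V) (t, y')].
  have oW' : open W := @slice_open _ t oW.
  have oU' := chart_atlas_open hM Ac oW'.
  have [|N [oN N0 Nd]] := atlas_open_near hM es oU'.
    by split=> //; rewrite /W /= cxy.
  apply: filterS2 (open_nbhs_nbhs (conj oN N0)) ge => z Nz gz.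
  have [cz [/= Vz Vbz]] := Nd z Nz.
  have [_ Dz cpz] := Vd _ _ Vz; rewrite (chart_invK _ (iA Ac) cz) in Dz cpz.
  have [_ Dbz _] := Vd _ _ Vbz.
  have ibz : chart_inv c x0 (flow_rep (t, c (eps z))) = phi t (eps z).
    by apply: invK => //; rewrite /flow_rep /= (chart_invK _ (iA Ac) cz).
  rewrite ibz in Dbz.
  by rewrite (add0 _ _ Dz Dbz).
have [_ Uo] := oU.
have oQ := openI (@slice_open _ t oV) (Uo c Ac).
have oV1 := smooth_preimage oV Vs oQ.
have oV1' : open [set y' | (V `&` flow_rep @^-1`
    ([set y | V (t, y)] `&` (c @` (chart_dom c `&` U)))) (- t, y')].
  exact: slice_open.
(* Three conditions on a point [z] of the chart: the flow is defined at time -t, it leads to a point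
   that can be flowed forward by t again, and that point lies in [U], where [eps] after [g] is the
   identity. *)
exists (chart_dom c `&` c @^-1` [set y' | (V `&` flow_rep @^-1`
    ([set y | V (t, y)] `&` (c @` (chart_dom c `&` U)))) (- t, y')]); split.
- exact: (chart_atlas_open hM Ac oV1').
- have fr : flow_rep (- t, c (phi t (eps 0))) = y.
    by rewrite /flow_rep /= (chart_invK _ (iA Ac) cphi) back_x.
  split=> //=; split.
    by move: Vback; rewrite /back /flow_rep /= -e0.
  by rewrite /= fr; split=> //; exists (eps 0).
move=> z [cz [/= Vz [Vtz [q [cq Uq] eqz]]]].
have [_ Dz cpz] := Vd _ _ Vz; rewrite (chart_invK _ (iA Ac) cz) in Dz cpz.
have frz : flow_rep (- t, c z) = c (phi (- t) z).
  by rewrite /flow_rep /= (chart_invK _ (iA Ac) cz).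
rewrite frz in Vtz eqz.
have qz : q = phi (- t) z by apply: (iA Ac) => //; rewrite inE.
have [_ Dtz _] := Vd _ _ Vtz; rewrite (chart_invK _ (iA Ac) cpz) in Dtz.
rewrite gU -?qz // qz.
have := add0 (- t) z Dz; rewrite opprK; exact.
Qed.

End box.
End flows.

(** * The natural lift in charts *)

Section natural_lift.
Variables (R : realType) (m : nat) (M : choiceType).
Variables (A : set (chart M 'cV[R]_m)) (hM : is_manifold [set: M] A).
Variables (xi : M -> tvec M 'cV[R]_m) (D : set (R^o * M)) (phi : R -> M -> M).
Hypothesis hphi : is_flow A xi D phi.
Implicit Types (u v : frame A) (c d : chart M 'cV[R]_m).

Let iA : inj_atlas A := manifold_inj hM.

(** The Jacobian in space only, written with directions (0, e_j) of the product so that it is smooth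
    in (t, y) jointly and can be differentiated in t. *)
Definition flow_jac c x0 (z : R^o * 'cV[R]_m) : 'M[R]_m :=
  \matrix_(i, j) ('D_((0, delta_mx j 0) : R^o * 'cV[R]_m) (flow_rep phi c x0)
    z) i 0.

Lemma flow_jac_smooth c x0 V : open V -> smooth_on V (flow_rep phi c x0) ->
  smooth_on V (flow_jac c x0).
Proof.
move=> oV Fs; apply: smooth_mx => // i j.
apply: (@smooth_ext _ _ _ _ (fun z =>
  ('D_((0, delta_mx j 0) : R^o * 'cV[R]_m) (flow_rep phi c x0) z) i 0)) => //.
  by move=> z _; rewrite mxE.
by apply: smooth_mx_coord => //; exact: smooth_derive.
Qed.

(** One chart [c] serves at the source and at the target, since for (t, y) in the box the flow stays
    in its domain. The lifted frame matrix is the old one multiplied on the left by a matrix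
    depending only on time and base point. *)
Lemma lift_chart c x0 : A c -> chart_dom c x0 ->
  exists V : set (R^o * 'cV[R]_m),
  [/\ open V, V (0, c x0), smooth_on V (flow_rep phi c x0) &
      forall t u, chart_dom c (frame_base u) -> V (t, c (frame_base u)) ->
      [/\ chart_dom c (frame_base (frame_lift (phi t) u)),
          frame_base (frame_lift (phi t) u) = phi t (frame_base u) &
          frame_chart A c (frame_lift (phi t) u) =
            (flow_rep phi c x0 (t, c (frame_base u)),
             flow_jac c x0 (t, c (frame_base u)) *m frame_mx c u)]].
Proof.
move=> Ac cx0; have [V [oV V0 Vs Vd]] := flow_box hM hphi Ac cx0.
exists V; split=> // t u cu Vtu.
have [yim cphi fs li] := Vd _ _ Vtu.
have iu : chart_inv c x0 (c (frame_base u)) = frame_base u.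
  exact: chart_invK (iA Ac) cu.
rewrite iu in cphi fs li.
have ue := frame_rep_mem u; have [ei _] := frame_mem ue.
have [bl Jl] := frame_lift_chart hM ue (li _ ei erefl) fs Ac Ac cu cphi.
have dl : chart_dom c (frame_base (frame_lift (phi t) u)) by rewrite bl.
have near_rep : \forall y \near c (frame_base u),
    local_rep (phi t) c c (frame_base u) y = flow_rep phi c x0 (t, y).
  have oim := chart_open hM Ac.
  apply: filterS (open_nbhs_nbhs (conj oim yim)) => _ [x cx <-].
  by rewrite /local_rep /flow_rep /= !(chart_invK _ (iA Ac) cx).
have Je : jac (local_rep (phi t) c c (frame_base u)) (c (frame_base u)) =
    flow_jac c x0 (t, c (frame_base u)).
  apply/matrixP => i j; rewrite !mxE -derive_slice2.
  exact: (congr1 (fun w : 'cV[R]_m => w i 0) (near_eq_derive (delta_mx j 0)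
    near_rep)).
split; [exact: dl|exact: bl|].
transitivity (c (frame_base (frame_lift (phi t) u)), frame_mx c (frame_lift
  (phi t) u)).
  by [].
by rewrite Jl Je bl /flow_rep /= iu.
Qed.

Lemma frame_lift0 u : frame_lift (phi 0) u = u.
Proof.
rewrite -[RHS](frame_lift_id u); congr (frame_lift _ u).
by apply/funext => x; exact: flow_id hphi x.
Qed.

Lemma smooth_slice1 (E F : normedModType R) (V : set (R^o * E)) (f : R^o * E
  -> F) y :
  findim E -> open V -> smooth_on V f ->
  open [set t : R^o | V (t, y)] /\ smooth_on [set t : R^o | V (t, y)] (fun t
    => f (t, y)).
Proof.
move=> fE oV fs.
have ps : smooth_on setT (fun t : R^o => (t, y)).
  by apply: smooth_pair; [exact: openT|exact: smooth_id|exact: smooth_cst].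
have oS : open [set t : R^o | V (t, y)].
  by have := smooth_preimage openT ps oV; rewrite setTI.
split=> //.
apply: (@smooth_comp _ _ _ _ _ _ V (fun t : R^o => (t, y)) f) => //.
exact: smooth_sub ps.
Qed.

Lemma lift_curve_smooth u :
  smooth_curve (frame_atlas A) (fun t => frame_lift (phi t) u).
Proof.
have [cs Acs dcs] : Defs.support A (frame_base u).
  by have -> := manifold_support hM.
split; first exact: full_support.
  by exists (frame_chart A cs);
    [exact: frame_atlas_chart|rewrite /= frame_lift0].
move=> _ e -> [c Ac <-] _ /=; rewrite frame_lift0 => cu.
have [V [oV V0 Vs Vd]] := lift_chart Ac cu.
set y := c (frame_base u) in V0.
have Js := flow_jac_smooth oV Vs.
have Ps : smooth_on V (fun z => (flow_rep phi c (frame_base u) z,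
    flow_jac c (frame_base u) z *m frame_mx c u)).
  exact: (smooth_pair oV Vs (smooth_mulmx oV Js (smooth_cst V (frame_mx c u)))).
have [oS Ss] := smooth_slice1 y (findim_matrix R m 1) oV Ps.
have fi (t : R^o) : chart_inv (@Chart R R^o R^o setT id) 0 t = t by exact:
  full_invE.
exists [set t : R^o | V (t, y)]; split=> //=.
  by move=> t Vt; rewrite fi; have [] := Vd t u cu Vt.
apply: smooth_ext Ss => // t Vt; rewrite fi.
by have [_ _ E] := Vd t u cu Vt; exact: esym E.
Qed.

Lemma lift_curve_base u :
  \forall t \near (0 : R^o), frame_base (frame_lift (phi t) u) = phi t
    (frame_base u).
Proof.
have [c Ac cu] : Defs.support A (frame_base u).
  by have -> := manifold_support hM.
have [V [oV V0 Vs Vd]] := lift_chart Ac cu.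
have [oS _] := smooth_slice1 (c (frame_base u)) (findim_matrix R m 1) oV Vs.
by apply: filterS (open_nbhs_nbhs (conj oS V0)) => t /= Vt; have [] :=
  Vd t u cu Vt.
Qed.

(** [a] and [b] are the time derivatives at 0 of the flow and of its spatial Jacobian. The frame
    enters only through its base point and the right factor [frame_mx c u]; this gives both
    smoothness along [P] and compatibility with the right action. *)
Lemma natural_lift_chart c x0 : A c -> chart_dom c x0 ->
  exists (N : set 'cV[R]_m) (a : 'cV[R]_m -> 'cV[R]_m) (b : 'cV[R]_m ->
    'M[R]_m),
  [/\ open N, N (c x0), smooth_on N a, smooth_on N b &
      forall u, chart_dom c (frame_base u) -> N (c (frame_base u)) ->
      natural_lift phi u (frame_chart A c) =
        (a (c (frame_base u)), b (c (frame_base u)) *m frame_mx c u)].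
Proof.
move=> Ac cx0; have [V [oV V0 Vs Vd]] := lift_chart Ac cx0.
have Js := flow_jac_smooth oV Vs.
pose e1 : R^o * 'cV[R]_m := (1, 0).
pose N := [set y | V (0, y)].
have oN : open N := @slice_open _ _ _ 0 oV.
have ps : smooth_on N (fun y : 'cV[R]_m => (0 : R^o, y)).
  by apply: smooth_pair => //; [exact: smooth_cst|exact: smooth_id].
exists N, (fun y => 'D_e1 (flow_rep phi c x0) (0, y)),
  (fun y => 'D_e1 (flow_jac c x0) (0, y)); split=> //.
- exact: (smooth_comp oN _ ps (smooth_derive _ Vs)).
- exact: (smooth_comp oN _ ps (smooth_derive _ Js)).
move=> u cu Nu.
have ls := lift_curve_smooth u.
have l0 : chart_dom c (frame_base (frame_lift (phi 0) u)) by rewrite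
  frame_lift0.
rewrite /natural_lift (frame_velocityE ls Ac l0).
have [oS Ss] := smooth_slice1 (c (frame_base u)) (findim_matrix R m 1) oV Vs.
have [_ Js1] := smooth_slice1 (c (frame_base u)) (findim_matrix R m 1) oV Js.
have nS := open_nbhs_nbhs (conj oS Nu).
congr pair.
  rewrite -derive_slice1; apply: near_eq_derive; apply: filterS nS => t Vt.
  by have [_ _ E] := Vd t u cu Vt; exact: (congr1 fst E).
transitivity ('D_1 ((fun t => flow_jac c x0 (t, c (frame_base u)) *m frame_mx
  c u)
    : R^o -> _) 0).
  apply: near_eq_derive; apply: filterS nS => t Vt.
  by have [_ _ E] := Vd t u cu Vt; exact: (congr1 snd E).
rewrite (derive_mulmx _ (smooth_differentiable Js1 Nu) (differentiable_cst _
  _)).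
by rewrite derive_cst mulmx0 add0r derive_slice1.
Qed.

End natural_lift.

(** * The matrix exponential *)

Section matrix_exponential.
Variables (R : realType) (m : nat).
Implicit Types (X : 'M[R]_m) (t : R).

Lemma limn_mx n p (u : nat -> 'M[R]_(n, p)) :
  (forall i j, cvgn (fun k => u k i j)) ->
  limn u = \matrix_(i, j) limn (fun k => u k i j).
Proof.
move=> uc; apply/cvg_lim => //; apply/cvgrPdist_le => /= e e0.
near=> k.
rewrite /Num.Def.normr/= mx_normrE (bigmax_le _ (ltW e0))//= => i _.
rewrite !mxE/=.
move: i; near: k; apply: filter_forall => /= i.
exact: ((cvgrPdist_le _ _).1 (uc i.1 i.2)).
Unshelve. all: by end_near. Qed.

(** Comparison with the exponential series at K |x|. The shape of the bound is chosen to survive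
    termwise differentiation. *)
Lemma pseries_cvg (c : nat -> R) (C K : R) x :
  (forall i, `|c i| <= C * (K ^+ i / i`!%:R)) -> cvgn (pseries c x).
Proof.
move=> cb; apply: normed_cvg.
have E i : (C *: exp_coeff (K * `|x|)) i = C * (K ^+ i / i`!%:R) * `|x| ^+ i.
  rewrite -[LHS]/(C * ((K * `|x|) ^+ i / i`!%:R)).
  rewrite exprMn -mulrA; congr (C * _).
  by rewrite mulrAC.
apply: (@series_le_cvg _ _ (C *: exp_coeff (K * `|x|))) => [i|i|i|].
- exact: normr_ge0.
- by rewrite E mulr_ge0 ?exprn_ge0 // (le_trans (normr_ge0 (c i))).
- by rewrite E /= normrM normrX ler_wpM2r ?exprn_ge0.
- exact: (is_cvg_seriesZ (is_cvg_series_exp_coeff _)).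
Qed.

(** Since (i+1) K^(i+1) / (i+1)! = K K^i / i!, differentiation only replaces the constant C by C K,
    so the bound can be iterated. *)
Lemma pseries_diffs_bound (c : nat -> R) (C K : R) :
  (forall i, `|c i| <= C * (K ^+ i / i`!%:R)) ->
  forall i, `|pseries_diffs c i| <= (C * K) * (K ^+ i / i`!%:R).
Proof.
move=> cb i; rewrite /pseries_diffs normrM ger0_norm //.
apply: le_trans (ler_wpM2l _ (cb i.+1)) _; first by [].
rewrite factS natrM exprS.
have i0 : (i.+1%:R : R) != 0 by rewrite pnatr_eq0.
have f0 : (i`!%:R : R) != 0 by rewrite pnatr_eq0 -lt0n fact_gt0.
rewrite le_eqVlt; apply/orP; left; apply/eqP.
by move: i.+1%:R i`!%:R i0 f0 => a f a0 f0; field; rewrite a0 f0.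
Qed.

Lemma pseries_at0 (c : nat -> R) : limn (pseries c 0) = c 0%N.
Proof.
apply/cvg_lim => //; apply: cvg_near_cst; exists 1%N => // n /= n0.
rewrite /pseries /series /= (big_ltn n0) expr0 mulr1 big1_seq ?addr0 // => i.
by rewrite mem_index_iota => /andP[_ /andP[i0 _]];
  rewrite expr0n gtn_eqF // mulr0.
Qed.

(** The sum of the absolute values of all entries dominates each absolute row sum of [X], so
    multiplying by [X] raises a bound on the entries by at most this factor. *)
Lemma expmx_bound X i j k :
  `|(X ^+ k) i j / k`!%:R| <= 1 * ((\sum_p \sum_q `|X p q|) ^+ k / k`!%:R).
Proof.
rewrite mul1r normrM normfV [X in _ / X]ger0_norm //.
rewrite ler_wpM2r ?invr_ge0 //.
elim: k i j => [|k IH] i j.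
  by rewrite !expr0 mxE; case: (i == j); rewrite ?normr1 ?normr0.
rewrite !exprS -[X * X ^+ k]/(X *m X ^+ k) mxE.
apply: le_trans (ler_norm_sum _ _ _) _.
apply: (@le_trans _ _ (\sum_q `|X i q| * (\sum_p \sum_q `|X p q|) ^+ k)).
  by apply: ler_sum => q _; rewrite normrM ler_wpM2l.
rewrite -mulr_suml ler_wpM2r ?exprn_ge0 ?sumr_ge0 // => [p _|].
  exact: sumr_ge0.
rewrite [leRHS](bigD1 i) //= lerDl; apply: sumr_ge0 => p _.
exact: sumr_ge0.
Qed.

Lemma expmxE X t i j :
  expmx (t *: X) i j = limn (pseries (fun k => (X ^+ k) i j / k`!%:R) t).
Proof.
have E p q : (fun n => series (fun k => (k`!%:R : R)^-1 *: (t *: X) ^+ k) n p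
  q) =
    pseries (fun k => (X ^+ k) p q / k`!%:R) t.
  apply/funext => n; rewrite /pseries /series /= summxE; apply: eq_bigr => k _.
  have -> : (t *: X) ^+ k = t ^+ k *: X ^+ k.
    elim: k => [|k IH]; first by rewrite !expr0 scale1r.
    rewrite !exprS IH -[_ * _ in LHS]/((t *: X) *m (t ^+ k *: X ^+ k)).
    by rewrite -scalemxAl -scalemxAr scalerA.
  rewrite !mxE mulrC -!mulrA [LHS]mulrC -mulrA; congr (_ * _).
rewrite /expmx limn_mx; first by rewrite mxE E.
by move=> p q; rewrite E; apply: pseries_cvg; exact: expmx_bound.
Qed.

Lemma expmx0 X : expmx (0 *: X) = 1%:M.
Proof.
by apply/matrixP => i j; rewrite expmxE pseries_at0 expr0 fact0 divr1.
Qed.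

Lemma expmx_derive X i j :
  is_derive (0 : R) 1 (fun t => expmx (t *: X) i j) (X i j).
Proof.
have cb := expmx_bound X i j.
have db := pseries_diffs_bound cb.
(* Termwise differentiation at 0, inside radius 1, from convergence at 1 of the series and of its
   first two derived series. The value at 0 is the coefficient of index 1, an entry of [X]. *)
have := @pseries_snd_diffs R (fun k => (X ^+ k) i j / k`!%:R) 1 0
  (pseries_cvg cb) (pseries_cvg db)
  (pseries_cvg (pseries_diffs_bound db)).
rewrite normr0 normr1 ltr01 => /(_ isT).
rewrite pseries_at0 /pseries_diffs expr1 (_ : (1`!)%:R = 1 :> R) // divr1 mul1r.
have -> : (fun t => expmx (t *: X) i j) =
  (fun t => limn (pseries (fun k => (X ^+ k) i j / k`!%:R) t)); last by [].
by apply/funext => t; rewrite expmxE.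
Qed.

Lemma expmx_differentiable X :
  differentiable ((fun t => expmx (t *: X)) : R^o -> 'M[R]_m) 0.
Proof.
apply/derivable1_diffP; apply/derivable_mxP => i j.
exact: (@ex_derive _ _ _ _ _ _ _ (expmx_derive X i j)).
Qed.

Lemma derive_expmx X :
  'D_1 ((fun t => expmx (t *: X)) : R^o -> 'M[R]_m) 0 = X.
Proof.
rewrite derive_mx; last by apply: diff_derivable; exact: expmx_differentiable.
apply/matrixP => i j; rewrite mxE.
exact: (@derive_val _ _ _ _ _ _ _ (expmx_derive X i j)).
Qed.

(** The determinant is continuous and equals 1 at t = 0; invertibility near 0 is enough for
    computing a velocity there. *)
Lemma expmx_unit X : \forall t \near (0 : R^o), expmx (t *: X) \in unitmx.
Proof.
have ec := differentiable_continuous (expmx_differentiable X).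
have dc : {for expmx (0 *: X), continuous (fun Y : 'M[R]_m => \det Y)}.
  exact: (smooth_continuous (smooth_det openT (smooth_id _)) I).
pose f (t : R^o) : R := \det (expmx (t *: X)).
have fc : {for 0, continuous f} := continuous_comp ec dc.
have f0 : nbhs (f 0) [set x : R | x != 0].
  rewrite /f expmx0 det1; apply: open_nbhs_nbhs; split; first exact: open_neq.
  exact: oner_neq0.
have H : \forall t \near (0 : R^o), f t != 0 by exact: fc _ f0.
by apply: filterS H => t ft; rewrite unitmxE unitfE.
Qed.

End matrix_exponential.

(** * Splitting the natural lift along P *)

Section smooth_curves.
Variable R : realType.
Implicit Types (S T : choiceType) (E F : normedModType R).

Lemma full_open E c : @full_atlas R E c -> open (c @` chart_dom c).
Proof.
move=> -> /=; rewrite (_ : [set _ | _ in _] = setT); first exact: openT.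
by apply/seteqP; split=> // x _; exists x.
Qed.

Lemma smooth_curve_comp S T E F {fE : findim E} (A : set (chart S E))
    (B : set (chart T F)) (f : S -> T) (g : R -> S) :
  inj_atlas A -> smooth_curve A g -> smooth_at A B f (g 0) ->
  smooth_curve B (fun t => f (g t)).
Proof. by move=> iA gs fs;
  exact: (smooth_at_comp (@full_inj R _) iA gs fs). Qed.

Lemma smooth_curve_cst T E (A : set (chart T E)) p :
  Defs.support A p -> smooth_curve A (fun=> p).
Proof.
move=> sp; apply: smooth_at_cst => //; first exact: full_open.
exact: full_support.
Qed.

Lemma smooth_curve_id : smooth_curve (@full_atlas R R^o) (fun t => t).
Proof. exact: (smooth_at_full openT I (smooth_id _)). Qed.

Lemma derive_pair E F (H : normedModType R) (f : E -> F) (g : E -> H) x v :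
  differentiable f x -> differentiable g x ->
  'D_v (fun y => (f y, g y)) x = ('D_v f x, 'D_v g x).
Proof.
move=> fd gd; rewrite (deriveE v fd) (deriveE v gd).
apply: etrans (deriveE v (differentiable_pair fd gd)) _.
exact: (congr1 (fun h => h v) (diff_pair fd gd)).
Qed.

(** Serves to replace a first component of zero velocity by a constant curve inside a product. *)
Lemma velocity_pair S T E F (A : set (chart S E)) (B : set (chart T F))
    (f f' : R -> S) (g : R -> T) :
  smooth_curve A f -> smooth_curve A f' -> smooth_curve B g ->
  f 0 = f' 0 -> velocity A f = velocity A f' ->
  velocity (prod_atlas A B) (fun t => (f t, g t)) =
  velocity (prod_atlas A B) (fun t => (f' t, g t)).
Proof.
move=> fs fs' gs f0 fv; apply/funext => e.
have [[ABe dome]|n] := pselect (prod_atlas A B e /\ chart_dom e (f 0, g 0));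
  last first.
  by rewrite !velocity_out // -f0.
have dome' : chart_dom e (f' 0, g 0) by rewrite -f0.
rewrite !velocityE //.
have [c [d [Ac Bd ee]]] := ABe; move: dome dome'; rewrite {e ABe}ee /=.
move=> [/= cf dg] [/= cf' _].
rewrite (derive_pair _ (curve_diff fs Ac cf) (curve_diff gs Bd dg)).
rewrite (derive_pair _ (curve_diff fs' Ac cf') (curve_diff gs Bd dg)).
by have := congr1 (fun w => w c) fv;
  rewrite (velocityE Ac cf) (velocityE Ac cf') => ->.
Qed.

End smooth_curves.

(** * The splitting at a single frame *)

Section pointwise_decomposition.
Variables (R : realType) (m k n : nat) (M : choiceType).
Variables (A : set (chart M 'cV[R]_m)) (hM : is_manifold [set: M] A).
Variables (G : set 'M[R]_m) (AG : set (chart 'M[R]_m 'cV[R]_k)).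
Hypothesis hG : lie_subgroup G AG.
Variables (P : set (frame A)) (AP : set (chart (frame A) 'cV[R]_n)).
Hypothesis hP : principal_subbundle G AG P AP.
Implicit Types (u : frame A) (c d : chart M 'cV[R]_m).

Let iA : inj_atlas A := manifold_inj hM.
Let iG : inj_atlas AG := manifold_inj (lie_subgroup_manifold hG).
Let iP : inj_atlas AP := manifold_inj (subbundle_manifold hP).

Lemma subgroup_support a : G a -> Defs.support AG a.
Proof. by rewrite (manifold_support (lie_subgroup_manifold hG)). Qed.

Lemma subbundle_support u : P u -> Defs.support AP u.
Proof. by rewrite (manifold_support (subbundle_manifold hP)). Qed.

Lemma curve_in_P g : smooth_curve AP g -> \forall t \near (0 : R^o), P (g t).
Proof.
move=> gs; have [_ [d APd dg] _] := gs.
apply: filterS (curve_near gs APd dg) => t dt.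
by rewrite -(manifold_support (subbundle_manifold hP)); exists d.
Qed.

Lemma frame_tvec_ext u (w w' : tvec (frame A) ('cV[R]_m * 'M[R]_m)%type) :
  (forall e, ~ (frame_atlas A e /\ chart_dom e u) -> w e = 0) ->
  (forall e, ~ (frame_atlas A e /\ chart_dom e u) -> w' e = 0) ->
  (forall c, A c -> chart_dom c (frame_base u) ->
     w (frame_chart A c) = w' (frame_chart A c)) -> w = w'.
Proof.
move=> w0 w0' ww; apply/funext => e.
have [[[c Ac <-] cu]|ne] := pselect (frame_atlas A e /\ chart_dom e u).
  exact: ww.
by rewrite w0 // w0'.
Qed.

(** In a chart the curve u a(t) has constant base point and matrix J a(t), with J the matrix of
    [u]. *)
Lemma act_velocity u (a : R -> 'M[R]_m) c : a 0 = 1%:M ->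
  differentiable (a : R^o -> 'M[R]_m) 0 ->
  (\forall t \near (0 : R^o), a t \in unitmx) ->
  A c -> chart_dom c (frame_base u) ->
  velocity (frame_atlas A) (fun t => frame_act u (a t)) (frame_chart A c) =
  (0, frame_mx c u *m 'D_1 (a : R^o -> 'M[R]_m) 0).
Proof.
move=> a0 ad au Ac cu.
have u0 : chart_dom (frame_chart A c) (frame_act u (a 0)).
  by rewrite a0 (frame_act1 hM).
rewrite (velocityE (frame_atlas_chart Ac) u0).
pose J := frame_mx c u.
have Jd := differentiable_mulmx (differentiable_cst J (0 : R^o)) ad.
transitivity ('D_1 ((fun t => (c (frame_base u), J *m a t)) : R^o -> _) 0).
  apply: near_eq_derive; apply: filterS au => t aut.
  transitivity (c (frame_base (frame_act u (a t))), frame_mx c (frame_act u (a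
    t))).
    by [].
  by rewrite (frame_act_base hM) // (frame_act_mx hM).
rewrite (derive_pair _ (differentiable_cst _ _) Jd) derive_cst; congr pair.
rewrite (derive_mulmx _ (differentiable_cst _ _) ad) derive_cst mul0mx.
by rewrite addr0.
Qed.

Lemma fibre_velocity u (mu : 'M[R]_m) c : A c -> chart_dom c (frame_base u) ->
  velocity (frame_atlas A) (fun t => frame_act u (expmx (t *: mu)))
    (frame_chart A c) = (0, frame_mx c u *m mu).
Proof.
move=> Ac cu; rewrite -[in RHS](derive_expmx mu); apply: act_velocity => //.
- exact: expmx0.
- exact: expmx_differentiable.
- exact: expmx_unit.
Qed.

Lemma fibre_velocity_out u (mu : 'M[R]_m) e :
  ~ (frame_atlas A e /\ chart_dom e u) ->
  velocity (frame_atlas A) (fun t => frame_act u (expmx (t *: mu))) e = 0.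
Proof. by move=> ne; apply: velocity_out; rewrite expmx0 (frame_act1 hM). Qed.

(** Smoothness for the group's own atlas passes to the matrix entries because the inclusion into GL
    is smooth. *)
Lemma group_curve (a : R -> 'M[R]_m) : smooth_curve AG a -> G (a 0) ->
  differentiable (a : R^o -> 'M[R]_m) 0 /\
  \forall t \near (0 : R^o), a t \in unitmx.
Proof.
move=> As Ga; have [is_ _] := lie_subgroup_immersion hG Ga.
pose proof (smooth_curve_comp iG As is_) as as_.
have au : chart_dom (@Chart R 'M[R]_m 'M[R]_m [set a | a \in unitmx] id) (a 0).
  exact: (lie_subgroup_unit hG Ga).
split; first exact: (curve_diff as_ erefl au).
exact: (curve_near as_ erefl au).
Qed.

Lemma act_curve u (a : R -> 'M[R]_m) : P u -> smooth_curve AG a -> a 0 = 1%:M ->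
  smooth_curve AP (fun t => frame_act u (a t)).
Proof.
move=> Pu As a0.
have G1 := lie_subgroup_one hG.
have := subbundle_smooth_act hP Pu G1; rewrite -a0 => acts.
have us := smooth_curve_cst (subbundle_support Pu).
exact: (smooth_curve_comp (prod_inj iP iG) (smooth_at_pair us As) acts).
Qed.

Lemma inclusion_velocity g : smooth_curve AP g -> P (g 0) ->
  smooth_curve (frame_atlas A) g /\
  tangent_map AP (frame_atlas A) id (g 0) (velocity AP g) =
    velocity (frame_atlas A) g.
Proof.
move=> gs Pg; have [is_ _] := subbundle_immersion hP Pg.
split; first exact: (smooth_curve_comp iP gs is_).
exact: (tangent_map_velocity iP gs is_).
Qed.

Section existence.
Variables (xi : M -> tvec M 'cV[R]_m) (D : set (R^o * M)) (phi : R -> M -> M).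
Hypothesis hphi : is_flow A xi D phi.
Variable mm : {vspace 'M[R]_m}.
Hypothesis hmm : reductive_complement G AG mm.

Lemma flow_curve x : smooth_curve A (fun t => phi t x).
Proof.
have sx : Defs.support A x by rewrite (manifold_support hM).
have xs := smooth_curve_cst sx.
exact: (smooth_curve_comp (prod_inj (@full_inj R _) iA)
  (smooth_at_pair (smooth_curve_id R) xs) (flow_smooth hphi (flow_zero hphi
    x))).
Qed.

Lemma decomposition_exists u : P u -> exists v w,
  [/\ is_tangent AP u v, transverse_fibre mm u w &
      natural_lift phi u = tangent_map AP (frame_atlas A) id u v \+ w].
Proof.
move=> Pu; pose x := frame_base u.
have [U [theta [tau [oU Ux [triv1 triv2]]]]] := subbundle_trivial hP x.
have [Gg _ tauu _] := triv1 u Pu Ux.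
have px0 : phi 0 x = x := flow_id hphi x.
have [_ _ _] := triv2 x (theta u) Ux Gg; rewrite -{1}px0 => taus.
have gs := smooth_curve_cst (subgroup_support Gg).
pose proof (smooth_curve_comp (prod_inj iA iG)
  (smooth_at_pair (flow_curve x) gs) taus) as g0s.
(* Freezing the group component at [theta u] turns [tau] into a local section of [P] through [u],
   evaluated along the flow line of [x]. *)
pose g0 t := tau (phi t x, theta u).
have g00 : g0 0 = u by rewrite /g0 px0 tauu.
have lift0 : frame_lift (phi 0) u = u := frame_lift0 hphi u.
have Pg0 : P (g0 0) by rewrite g00.
have [g0L g0T] := inclusion_velocity (g := g0) g0s Pg0.
have ls := lift_curve_smooth hM hphi u.
have [|X EX] := vertical_difference hM ls g0L (etrans lift0 (esym g00)).
  have [|N [oN N0 NU]] := atlas_open_near hM (flow_curve x) oU.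
    by rewrite px0.
  apply: filterS2 (lift_curve_base hM hphi u) (open_nbhs_nbhs (conj oN N0)).
  move=> t -> /NU Ut; rewrite /g0.
  by have [_ ->] := triv2 _ _ Ut Gg.
have [/(_ X)[Y [Z [[a [As a0 aY]] Zm XYZ]]] _ _] := hmm.
have Ga0 : G (a 0) by rewrite a0; exact: lie_subgroup_one hG.
have [ad au] := group_curve As Ga0.
have acts := act_curve Pu As a0.
have act0 : frame_act u (a 0) = u by rewrite a0 (frame_act1 hM).
have Pact0 : P (frame_act u (a 0)) by rewrite act0.
have [actL actT] := inclusion_velocity acts Pact0.
rewrite act0 in actT; rewrite g00 in g0T.
have t0 : is_tangent AP (g0 0) (velocity AP g0).
  exact: (velocity_tangent (subbundle_manifold hP) g0s).
have t1 : is_tangent AP (frame_act u (a 0)) (velocity AP (fun t => frame_act u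
  (a t))).
  exact: (velocity_tangent (subbundle_manifold hP) acts).
rewrite g00 in t0; rewrite act0 in t1.
have [is_ _] := subbundle_immersion hP Pu.
(* Velocity of the section curve plus that of u a(t), where [a] has velocity the Lie algebra part
   [Y] of [X]. The scalar 1 fits the form of [tangent_map_lin]. *)
exists (fun e => 1 *: velocity AP g0 e + velocity AP (fun t => frame_act u (a
  t)) e),
  (velocity (frame_atlas A) (fun t => frame_act u (expmx (t *: Z)))).
split; first exact: (tangent_lin 1 t0 t1).
  by exists Z; [exact: Zm|reflexivity].
have L := tangent_map_lin (findim_matrix R n 1) (subbundle_manifold hP) 1 is_
  t0 t1.
rewrite g0T actT in L; rewrite L.
apply: (frame_tvec_ext (u := u)).
- by move=> e ne; rewrite /natural_lift velocity_out //= lift0; exact: ne.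
- move=> e ne; rewrite /= fibre_velocity_out // !velocity_out ?g00 ?act0 //.
  by rewrite scaler0 !addr0.
move=> c Ac cu; rewrite /= fibre_velocity // scale1r.
rewrite (act_velocity a0 ad au Ac cu) -derive1E aY /natural_lift.
have cl : chart_dom c (frame_base (frame_lift (phi 0) u)) by rewrite lift0.
rewrite EX // lift0 XYZ mulmxDr -addrA; congr (_ + _).
by rewrite -[RHS]/(0 + 0, _ + _) addr0.
Qed.

End existence.

Section uniqueness.
Variable mm : {vspace 'M[R]_m}.
Hypothesis hmm : reductive_complement G AG mm.

(* A tangent vector of P projecting to 0 on M is the velocity of u . a(t) for
   a curve a in G, by the local triviality of P. *)
Lemma vertical_tangent u v c : P u -> is_tangent AP u v ->
  A c -> chart_dom c (frame_base u) ->
  (tangent_map AP (frame_atlas A) id u v (frame_chart A c)).1 = 0 ->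
  exists a : R -> 'M[R]_m, [/\ smooth_curve AG a, a 0 = 1%:M &
    v = velocity AP (fun t => frame_act u (a t))].
Proof.
move=> Pu vt Ac cu v0; have mP := subbundle_manifold hP.
have [g [g0 gs gv]] := tangent_velocity (findim_matrix R n 1) mP
  (subbundle_support Pu) vt.
have Pg : P (g 0) by rewrite g0.
have [gL gT] := inclusion_velocity gs Pg.
have cg : chart_dom c (frame_base (g 0)) by rewrite g0.
pose proof (smooth_curve_comp iP gs (subbundle_projection hP Pg)) as bs.
have bv : velocity A (fun t => frame_base (g t)) = fun=> 0.
  apply: (tangent_eq (velocity_tangent hM bs) (tangent0 _ _) Ac cg).
  rewrite (velocityE Ac cg).
  have := v0; rewrite -gv -g0 gT.
  by rewrite (frame_velocityE gL Ac cg).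
pose x := frame_base u.
have [U [theta [tau [oU Ux [triv1 triv2]]]]] := subbundle_trivial hP x.
have [Gg ths tauu thact] := triv1 u Pu Ux.
have sx : Defs.support A x by rewrite (manifold_support hM).
have xs := smooth_curve_cst sx.
have ths' : smooth_curve AG (fun t => theta (g t)).
  by apply: (smooth_curve_comp iP gs); rewrite g0.
have Ggi := lie_subgroup_inv hG Gg.
have gu := lie_subgroup_unit hG Gg.
(* By equivariance theta(u a) = theta(u) a, so this is the group element that takes [u] to the point
   over [x] with the same group component as [g t]; it is 1 at t = 0. *)
pose a t := invmx (theta u) *m theta (g t).
have as_ : smooth_curve AG a.
  have muls := lie_subgroup_smooth_mul hG Ggi Gg.
  rewrite -{2}g0 in muls.
  exact: (smooth_curve_comp (prod_inj iG iG)
    (smooth_at_pair (smooth_curve_cst (subgroup_support Ggi)) ths') muls).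
have a0 : a 0 = 1%:M by rewrite /a g0 mulVmx.
exists a; split=> //.
have [|N [oN N0 NU]] := atlas_open_near hM bs oU; first by rewrite g0.
have near_triv : \forall t \near (0 : R^o), P (g t) /\ U (frame_base (g t)).
  apply: filterS2 (curve_in_P gs) (open_nbhs_nbhs (conj oN N0)) => t Pt /NU Ut.
  by split.
have taus : smooth_at (prod_atlas A AG) AP tau (x, theta u).
  by have [] := triv2 x (theta u) Ux Gg.
have taus1 : smooth_at (prod_atlas A AG) AP tau (frame_base (g 0), theta (g 0)).
  by rewrite g0.
have taus2 : smooth_at (prod_atlas A AG) AP tau (x, theta (g 0)) by rewrite g0.
rewrite -gv.
(* The curve [g] is tau(base point, group component). Its base curve has zero velocity and may be
   replaced by the constant [x] without changing the velocity; what remains is tau(x, theta(g t)) =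
   u a(t). *)
transitivity (velocity AP (fun t => tau (frame_base (g t), theta (g t)))).
  apply: velocity_near; apply: filterS near_triv => t [Pt Ut].
  by have [_ _ ->] := triv1 _ Pt Ut.
have iAG := prod_inj iA iG.
rewrite -(tangent_map_velocity iAG (smooth_at_pair bs ths') taus1).
have b0 : frame_base (g 0) = x by rewrite g0.
rewrite (velocity_pair bs xs ths' b0); last first.
  rewrite bv; apply/funext => e.
  have [[Ae ex]|ne] := pselect (A e /\ chart_dom e x);
    last by rewrite velocity_out.
  by rewrite velocityE // derive_cst.
rewrite b0 (tangent_map_velocity iAG (smooth_at_pair xs ths') taus2).
apply: velocity_near; apply: filterS near_triv => t [Pt Ut].
have [Gt _ _ _] := triv1 _ Pt Ut.
have Gat : G (a t) by exact: lie_subgroup_mul hG _ _ Ggi Gt.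
have aut := lie_subgroup_unit hG Gat.
have Put := subbundle_act hP Pu Gat.
have bt : frame_base (frame_act u (a t)) = x by rewrite (frame_act_base hM).
have [|_ _ <- _] := triv1 _ Put; first by rewrite bt.
by rewrite bt thact // /a mulKVmx.
Qed.

(** The base component forces [v] to be vertical, hence generated by some Y in the Lie algebra; then
    Y = -mu lies in both summands and vanishes, and the immersion property gives v = 0. This form
    serves both uniqueness and the linear independence behind smoothness. *)
Lemma vertical_kernel_trivial u v (mu : 'M[R]_m) c : P u -> is_tangent AP u v ->
  mu \in mm -> A c -> chart_dom c (frame_base u) ->
  tangent_map AP (frame_atlas A) id u v (frame_chart A c) +
    (0, frame_mx c u *m mu) = 0 ->
  v = (fun=> 0) /\ mu = 0.
Proof.
move=> Pu vt mum Ac cu E.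
have E1 := congr1 fst E; rewrite /= addr0 in E1.
have [a [as_ a0 va]] := vertical_tangent Pu vt Ac cu E1.
have Ga0 : G (a 0) by rewrite a0; exact: lie_subgroup_one hG.
have [ad au] := group_curve as_ Ga0.
have act0 : frame_act u (a 0) = u by rewrite a0 (frame_act1 hM).
have Pact0 : P (frame_act u (a 0)) by rewrite act0.
have [_] := inclusion_velocity (act_curve Pu as_ a0) Pact0.
rewrite act0 -va => vT.
pose Y := 'D_1 (a : R^o -> 'M[R]_m) 0.
have YT d : A d -> chart_dom d (frame_base u) ->
    tangent_map AP (frame_atlas A) id u v (frame_chart A d) =
    (0, frame_mx d u *m Y).
  by move=> Ad du; rewrite vT (act_velocity a0 ad au Ad du).
have Ymu : Y + mu = 0.
  have := congr1 snd E; rewrite YT //= -mulmxDr => /(congr1 (mulmx (invmx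
    (frame_mx c u)))).
  by rewrite mulKmx ?mulmx0 // (frame_mx_unit hM).
have LY : lie_algebra AG Y.
  by exists a; split; [exact: as_|exact: a0|exact: derive1E].
have Y0 : Y = 0.
  have [_ inj _] := hmm; apply: (inj Y LY).
  have -> : Y = - mu by apply: (addIr mu); rewrite Ymu addNr.
  by rewrite memvN.
split; last by rewrite -Ymu Y0 add0r.
have [_ imm] := subbundle_immersion hP Pu; apply: imm => //.
apply: (frame_tvec_ext (u := u)) => // [e ne|].
  by apply: tangent_map_out; exact: ne.
by move=> d Ad du; rewrite YT // Y0 mulmx0.
Qed.

End uniqueness.
End pointwise_decomposition.

(** * Uniqueness, smoothness and invariance of the components *)

Section smooth_decomposition.
Variables (R : realType) (m k n : nat) (M : choiceType).
Variables (A : set (chart M 'cV[R]_m)) (hM : is_manifold [set: M] A).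
Variables (G : set 'M[R]_m) (AG : set (chart 'M[R]_m 'cV[R]_k)).
Hypothesis hG : lie_subgroup G AG.
Variables (P : set (frame A)) (AP : set (chart (frame A) 'cV[R]_n)).
Hypothesis hP : principal_subbundle G AG P AP.
Variable mm : {vspace 'M[R]_m}.
Hypothesis hmm : reductive_complement G AG mm.
Variables (xi : M -> tvec M 'cV[R]_m) (D : set (R^o * M)) (phi : R -> M -> M).
Hypothesis hphi : is_flow A xi D phi.

Let mP := subbundle_manifold hP.
Let iP : inj_atlas AP := manifold_inj mP.

Lemma frame_chart_exists (u : frame A) :
  exists2 c, A c & chart_dom c (frame_base u).
Proof.
suff : Defs.support A (frame_base u) by [].
by rewrite (manifold_support hM).
Qed.

Lemma subr_cross (V : zmodType) (x y x' y' : V) :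
  x + y = x' + y' -> - x' + x + (y - y') = 0.
Proof. by move=> e; rewrite [- x' + x]addrC addrACA -opprD e subrr. Qed.

Lemma decomposition_unique u v w v' w' : P u ->
  is_tangent AP u v -> transverse_fibre mm u w ->
  is_tangent AP u v' -> transverse_fibre mm u w' ->
  tangent_map AP (frame_atlas A) id u v \+ w =
  tangent_map AP (frame_atlas A) id u v' \+ w' -> v = v' /\ w = w'.
Proof.
move=> Pu vt [mu mum ew] vt' [mu' mum' ew'] E.
have [c Ac cu] := frame_chart_exists u.
have [is_ _] := subbundle_immersion hP Pu.
have L := tangent_map_lin (findim_matrix R n 1) mP (-1) is_ vt' vt.
have wc : w (frame_chart A c) = (0, frame_mx c u *m mu).
  by rewrite ew; exact: fibre_velocity.
have wc' : w' (frame_chart A c) = (0, frame_mx c u *m mu').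
  by rewrite ew'; exact: fibre_velocity.
have Ec : tangent_map AP (frame_atlas A) id u v (frame_chart A c) +
      (0, frame_mx c u *m mu) =
    tangent_map AP (frame_atlas A) id u v' (frame_chart A c) +
      (0, frame_mx c u *m mu').
  by rewrite -wc -wc'; exact: (congr1 (fun w => w (frame_chart A c)) E).
(* Applied to the difference of the two decompositions, with v - v' written as (-1) v' + v to match
   [tangent_map_lin]. *)
have [||x0 mu0] := vertical_kernel_trivial hM hG hP hmm Pu (tangent_lin (-1)
  vt' vt)
    (mu := mu - mu') _ Ac cu.
- by rewrite memvB.
- rewrite L mulmxBr scaleN1r.
  have -> : (0, frame_mx c u *m mu - frame_mx c u *m mu') =
    (0, frame_mx c u *m mu) - (0, frame_mx c u *m mu') :> ('cV[R]_m *
      'M[R]_m)%type.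
    by rewrite -[RHS]/(0 - 0, _ - _) subr0.
  exact: subr_cross Ec.
have emu : mu = mu' by apply/eqP; rewrite -subr_eq0 mu0.
split; last by rewrite -emu in ew'; exact: (etrans ew (esym ew')).
apply/funext => e; have := congr1 (fun w => w e) x0.
by rewrite /= scaleN1r addrC => /subr0_eq.
Qed.

Lemma sum_vertical (J : 'M[R]_m) (I : finType) (b : I -> R) (Z : I -> 'M[R]_m) :
  \sum_i b i *: ((0, J *m Z i) : 'cV[R]_m * 'M[R]_m) =
  (0, J *m \sum_i b i *: Z i).
Proof.
transitivity (\sum_i Linear (@inr_linear R 'cV[R]_m 'M[R]_m) (J *m (b i *: Z
  i))).
  by apply: eq_bigr => i _; rewrite -scalemxAr linearZ.
by rewrite -linear_sum mulmx_sumr.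
Qed.

(** The base point of [chart_inv] is only a default value, so on the image of [d] it may be frozen
    at [u0]. One and the same map then provides the partial derivatives at every [q]. *)
Lemma tangent_inclusionE u0 c d q v : P u0 -> A c -> AP d ->
  chart_dom c (frame_base q) -> chart_dom d q -> is_tangent AP q v ->
  tangent_map AP (frame_atlas A) id q v (frame_chart A c) =
  \sum_j v d j 0 *:
    'D_(delta_mx j 0) (fun y => frame_chart A c (chart_inv d u0 y)) (d q).
Proof.
move=> Pu0 Ac APd cq dq vt.
have Pq : P q by rewrite -(manifold_support mP); exists d.
have [is_ _] := subbundle_immersion hP Pq.
rewrite (tangent_mapE (findim_matrix R n 1) mP is_ vt APd dq
  (frame_atlas_chart Ac) cq).
have [_ _ iss] := is_.
have [V [oV Vq Vim Vd Vs]] :=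
  iss d (frame_chart A c) APd (frame_atlas_chart Ac) dq cq.
have fd := smooth_differentiable Vs Vq.
have near_inv : \forall y \near d q, frame_chart A c (chart_inv d q y) =
    frame_chart A c (chart_inv d u0 y).
  apply: filterS (open_nbhs_nbhs (conj oV Vq)) => y /Vim [q' dq' <-].
  by rewrite !(chart_invK _ (iP APd) dq').
rewrite {1}[v d](matrix_sum_delta (v d)) linear_sum.
apply: eq_bigr => j _; rewrite big_ord1 linearZ; congr (_ *: _).
by rewrite -(near_eq_derive _ near_inv) (deriveE _ fd).
Qed.

Variables (xiK : frame A -> tvec (frame A) 'cV[R]_n)
  (xiG : frame A -> tvec (frame A) ('cV[R]_m * 'M[R]_m)%type).
Hypothesis dec : forall u, P u ->
  [/\ is_tangent AP u (xiK u), transverse_fibre mm u (xiG u) &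
      natural_lift phi u =
      tangent_map AP (frame_atlas A) id u (xiK u) \+ xiG u].

Lemma decomposition_smooth u0 c d : P u0 -> A c -> AP d ->
  chart_dom c (frame_base u0) -> chart_dom d u0 ->
  smooth_at AP (@full_atlas R 'cV[R]_n) (fun q => xiK q d) u0 /\
  smooth_at AP (@full_atlas R ('cV[R]_m * 'M[R]_m)%type)
    (fun q => xiG q (frame_chart A c)) u0.
Proof.
move=> Pu0 Ac APd cu0 du0.
pose psi y := frame_chart A c (chart_inv d u0 y).
have [[_ _ iss] _] := subbundle_immersion hP Pu0.
have [V1 [oV1 V1u0 V1im V1d psis]] :=
  iss d (frame_chart A c) APd (frame_atlas_chart Ac) du0 cu0.
have psi1 : smooth_on V1 (fun y => (psi y).1).
  exact: (smooth_lin (Linear (@fst_linear R _ _)) oV1 psis).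
have psi2 : smooth_on V1 (fun y => (psi y).2).
  exact: (smooth_lin (Linear (@snd_linear R _ _)) oV1 psis).
have [N [a [b [oN Nu0 as_ bs lift]]]] := natural_lift_chart hM hphi Ac cu0.
have psiE q : chart_dom d q -> psi (d q) = frame_chart A c q.
  by move=> dq; rewrite /psi (chart_invK _ (iP APd) dq).
(* Restricts to frames whose base coordinates lie in [N], where the chart formula of the natural
   lift is valid. *)
pose V2 := V1 `&` (fun y => (psi y).1) @^-1` N.
have oV2 : open V2 := smooth_preimage oV1 psi1 oN.
have V2u0 : V2 (d u0).
  by split; [exact: V1u0|rewrite /preimage /mkset psiE].
have V21 : V2 `<=` V1 by move=> y [].
(* The frame of vectors adapted to the splitting: the partial derivatives of the inclusion span the
   image of the tangent space of [P], and the products of the frame matrix with a basis of [mm] span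
   the transverse fibre. *)
pose Phi (j : 'I_n + 'I_(\dim mm)) y := match j with
  | inl j => 'D_(delta_mx j 0) psi y
  | inr j => (0, (psi y).2 *m (vbasis mm)`_j) end.
have Phi_smooth j : smooth_on V2 (Phi j).
  case: j => j.
    exact: (smooth_sub V21 (smooth_derive (delta_mx j 0) psis)).
  apply: (smooth_pair oV2 (smooth_cst _ _)).
  exact: (smooth_mulmx oV2 (smooth_sub V21 psi2) (smooth_cst _ _)).
pose w y := (a (psi y).1, b (psi y).1 *m (psi y).2).
have ws : smooth_on V2 w.
  have N2 y : V2 y -> N (psi y).1 by case.
  have p1 := smooth_sub V21 psi1.
  apply: (smooth_pair oV2 (smooth_comp oV2 N2 p1 as_)).
  exact: (smooth_mulmx oV2 (smooth_comp oV2 N2 p1 bs) (smooth_sub V21 psi2)).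
have inj (x : 'I_n + 'I_(\dim mm) -> R) :
    \sum_j x j *: Phi j (d u0) = 0 -> forall j, x j = 0.
  rewrite big_sumType /= => E.
  (* The first n coefficients are the components in [d] of an actual tangent vector of [P], the
     others define an element of [mm]; a linear relation is then an instance of
     [vertical_kernel_trivial]. *)
  have [g [g0 gs gv]] := curve_of_vector (findim_matrix R n 1) mP
    (\col_j x (inl j)) APd du0.
  have vt := velocity_tangent mP gs; rewrite g0 in vt.
  pose mu := \sum_j x (inr j) *: (vbasis mm)`_j.
  have mum : mu \in mm.
    apply: memv_suml => j _; apply: memvZ.
    by apply: vbasis_mem; apply: mem_nth; rewrite size_tuple.
  have [|v0 mu0] := vertical_kernel_trivial hM hG hP hmm Pu0 vt mum Ac cu0.
    have Jpsi : frame_mx c u0 = (psi (d u0)).2 by rewrite psiE.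
    have vE : tangent_map AP (frame_atlas A) id u0 (velocity AP g)
      (frame_chart A c) =
        \sum_j x (inl j) *: Phi (inl j) (d u0).
      rewrite (tangent_inclusionE Pu0 Ac APd cu0 du0 vt) gv.
      by apply: eq_bigr => j _; rewrite mxE.
    by rewrite vE Jpsi -sum_vertical; exact: E.
  case=> j.
    have := congr1 (fun v : tvec (frame A) 'cV[R]_n => v d j 0) v0.
    by rewrite gv !mxE.
  have /freeP fr := basis_free (vbasisP mm).
  exact: (fr (fun j => x (inr j)) mu0 j).
have [V [s [oV Vu0 VV2 ss sol]]] := smooth_solve oV2 V2u0 Phi_smooth ws inj.
have solK q : chart_dom d q -> V (d q) ->
    xiK q d = \col_j s (inl j) (d q) /\
    xiG q (frame_chart A c) =
      (0, (psi (d q)).2 *m \sum_j s (inr j) (d q) *: (vbasis mm)`_j).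
  move=> dq Vq; have [V1q Nq] := VV2 _ Vq.
  have Pq : P q by rewrite -(manifold_support mP); exists d.
  have cq : chart_dom c (frame_base q).
    by have := V1d _ V1q; rewrite (chart_invK _ (iP APd) dq).
  have [vt [mu mum eG] E] := dec Pq.
  have G_mu : xiG q (frame_chart A c) = (0, (psi (d q)).2 *m mu).
    by rewrite psiE // eG; exact: (fibre_velocity hM mu Ac cq).
  (* The components of the given decomposition, in the chart [d] and in the basis of [mm], solve the
     linear system and hence coincide with its smooth solution. *)
  pose x (j : 'I_n + 'I_(\dim mm)) := match j with
    | inl j => xiK q d j 0 | inr j => coord (vbasis mm) j mu end.
  have mux : mu = \sum_j x (inr j) *: (vbasis mm)`_j by exact: coord_vbasis.
  have wx : w (d q) = \sum_j x j *: Phi j (d q).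
    have -> : w (d q) = natural_lift phi q (frame_chart A c).
      rewrite (lift q cq); first by rewrite /w psiE.
      by move: Nq; rewrite /preimage /mkset psiE.
    rewrite E /= (tangent_inclusionE Pu0 Ac APd cq dq vt) G_mu big_sumType /=.
    by rewrite [in LHS]mux -sum_vertical.
  have sx := sol _ _ Vq wx.
  split; first by apply/colP => j; rewrite mxE -sx.
  rewrite G_mu [in LHS]mux; congr (0, _ *m _).
  by apply: eq_bigr => j _; rewrite -sx.
split.
  apply: (smooth_at_factor (findim_matrix R n 1) mP (V := V)
    (W := fun y => \col_j s (inl j) y) APd du0 oV Vu0) => [|q dq Vq].
    apply: smooth_mx => // i j.
    apply: (@smooth_ext _ _ _ _ (fun y => s (inl i) y)) => // y _.
    by rewrite mxE.
  by have [] := solK q dq Vq.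
apply: (smooth_at_factor (findim_matrix R n 1) mP (V := V)
  (W := fun y => (0, (psi y).2 *m \sum_j s (inr j) y *: (vbasis mm)`_j))
  APd du0 oV Vu0) => [|q dq Vq]; last by have [] := solK q dq Vq.
apply: (smooth_pair oV (smooth_cst _ _)); apply: (smooth_mulmx oV).
  exact: (smooth_sub (subset_trans VV2 V21) psi2).
apply: (smooth_sum _ oV) => j.
exact: (smoothZ oV (ss (inr j)) (smooth_cst _ _)).
Qed.

(** Right multiplication by [a] commutes with the left factor in [natural_lift_chart], and the base
    point is unchanged. *)
Lemma natural_lift_act u (a : 'M[R]_m) c : a \in unitmx -> A c ->
  chart_dom c (frame_base u) ->
  natural_lift phi (frame_act u a) (frame_chart A c) =
  ((natural_lift phi u (frame_chart A c)).1,
   (natural_lift phi u (frame_chart A c)).2 *m a).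
Proof.
move=> au Ac cu.
have [N [f [b [oN Nu _ _ lift]]]] := natural_lift_chart hM hphi Ac cu.
rewrite (lift u cu Nu) lift (frame_act_base hM) // (frame_act_mx hM) //=.
by rewrite mulmxA.
Qed.

Lemma kosmann_invariant : G_invariant G P AP xiK.
Proof.
move=> u a Pu Ga; have [vt [mu mum eG] E] := dec Pu.
have Pua := subbundle_act hP Pu Ga.
have au := lie_subgroup_unit hG Ga.
have [g [g0 gs gv]] := tangent_velocity (findim_matrix R n 1) mP
  (subbundle_support hP Pu) vt.
have sa : Defs.support AG a by exact: (subgroup_support hG Ga).
have acts : smooth_at AP AP (fun v => frame_act v a) u.
  have ps : smooth_at AP (prod_atlas AP AG) (fun v => (v, a)) u.
    apply: smooth_at_pair; first exact: (smooth_at_id mP (subbundle_support hP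
      Pu)).
    apply: smooth_at_cst => //; last exact: (subbundle_support hP Pu).
    by move=> e APe; exact: (chart_open mP APe).
  have iG : inj_atlas AG := manifold_inj (lie_subgroup_manifold hG).
  exact: (smooth_at_comp iP (prod_inj iP iG) ps (subbundle_smooth_act hP Pu
    Ga)).
pose proof (tangent_map_tangent mP mP acts vt) as Tt.
have [vt' fG' E'] := dec Pua.
(* Translating by [a] sends u exp(t mu) to (u a) exp(t a^-1 mu a). The double inverse matches the
   Ad-stability condition taken at [invmx a]. *)
pose mu' := invmx a *m mu *m invmx (invmx a).
have mum' : mu' \in mm.
  by have [_ _ Ad] := hmm; exact: (Ad _ _ (lie_subgroup_inv hG Ga) mum).
pose w' := velocity (frame_atlas A) (fun t => frame_act (frame_act u a) (expmx
  (t *: mu'))).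
have fw' : transverse_fibre mm (frame_act u a) w'.
  by exists mu'; [exact: mum'|reflexivity].
suff Ew : tangent_map AP (frame_atlas A) id (frame_act u a)
      (tangent_map AP AP (fun v => frame_act v a) u (xiK u)) \+ w' =
    natural_lift phi (frame_act u a).
  by have [] := decomposition_unique Pua Tt fw' vt' fG' (etrans Ew E').
have gas : smooth_at AP AP (fun v => frame_act v a) (g 0) by rewrite g0.
have T1 : tangent_map AP AP (fun v => frame_act v a) u (xiK u) =
    velocity AP (fun t => frame_act (g t) a).
  by rewrite -gv -g0; exact: (tangent_map_velocity iP gs gas).
have Pg : P (g 0) by rewrite g0.
have Pga : P (frame_act (g 0) a) by rewrite g0.
pose proof (smooth_curve_comp iP gs gas) as gas'.
have [gaL gaT] := inclusion_velocity hP gas' Pga; rewrite g0 in gaT.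
have [gL gT] := inclusion_velocity hP gs Pg; rewrite g0 gv in gT.
rewrite T1 gaT; apply: (frame_tvec_ext (u := frame_act u a)).
- move=> e ne; rewrite /= /w' (fibre_velocity_out hM) // velocity_out ?addr0
  // g0.
  exact: ne.
- move=> e ne; rewrite /natural_lift velocity_out // (frame_lift0 hphi).
  exact: ne.
move=> c Ac; rewrite (frame_act_base hM) // => cu.
have cua : chart_dom c (frame_base (frame_act u a)) by rewrite (frame_act_base
  hM).
have cg : chart_dom c (frame_base (g 0)) by rewrite g0.
have cga : chart_dom c (frame_base (frame_act (g 0) a)) by rewrite g0.
have wE : w' (frame_chart A c) = (0, frame_mx c u *m a *m mu').
  rewrite -(frame_act_mx hM au Ac cu).
  exact: (fibre_velocity hM mu' Ac cua).
have GE : xiG u (frame_chart A c) = (0, frame_mx c u *m mu).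
  by rewrite eG; exact: (fibre_velocity hM mu Ac cu).
rewrite (natural_lift_act au Ac cu) E gT.
rewrite -[LHS]/(velocity (frame_atlas A) (fun t => frame_act (g t) a)
  (frame_chart A c) + w' (frame_chart A c)).
rewrite -[(velocity _ _ \+ _) _]/(velocity (frame_atlas A) g (frame_chart A c) +
  xiG u (frame_chart A c)).
rewrite wE GE (frame_velocityE gL Ac cg) (frame_velocityE gaL Ac cga).
have dom : \forall t \near (0 : R^o), chart_dom c (frame_base (g t)).
  exact: (curve_near gL (frame_atlas_chart Ac) cg).
have -> : 'D_1 ((fun t => frame_mx c (frame_act (g t) a)) : R^o -> _) 0 =
    'D_1 ((fun t => frame_mx c (g t)) : R^o -> _) 0 *m a.
  transitivity ('D_1 ((fun t => frame_mx c (g t) *m a) : R^o -> _) 0).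
    apply: near_eq_derive; apply: filterS dom => t ct.
    by rewrite (frame_act_mx hM).
  rewrite (derive_mulmx _ (frame_mx_diff gL Ac cg) (differentiable_cst _ _)).
  by rewrite derive_cst mulmx0 add0r.
have -> : 'D_1 ((fun t => c (frame_base (frame_act (g t) a))) : R^o -> _) 0 =
    'D_1 ((fun t => c (frame_base (g t))) : R^o -> _) 0.
  by apply: near_eq_derive; near=> t; rewrite (frame_act_base hM).
congr pair; rewrite /= mulmxDl; congr (_ + _).
by rewrite /mu' invmxK !mulmxA mulmxK.
Unshelve. all: by end_near. Qed.

End smooth_decomposition.

Theorem corollary4p15 (R : realType) (m k n : nat) (M : choiceType)
    (A : set (chart M 'cV[R]_m)) (hM : is_manifold [set: M] A)
    (G : set 'M[R]_m) (AG : set (chart 'M[R]_m 'cV[R]_k))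
    (hG : lie_subgroup G AG)
    (mm : {vspace 'M[R]_m}) (hmm : reductive_complement G AG mm)
    (P : set (frame A)) (AP : set (chart (frame A) 'cV[R]_n))
    (hP : principal_subbundle G AG P AP)
    (xi : M -> tvec M 'cV[R]_m) (hxi : vector_field A xi)
    (D : set (R^o * M)) (phi : R -> M -> M) (hphi : is_flow A xi D phi) :
  exists (xiK : frame A -> tvec (frame A) 'cV[R]_n)
         (xiG : frame A -> tvec (frame A) ('cV[R]_m * 'M[R]_m)%type),
    [/\ vector_field AP xiK,
        G_invariant G P AP xiK,
        transverse_field mm P AP xiG,
        (forall u, P u ->
           natural_lift phi u =
           tangent_map AP (frame_atlas A) id u (xiK u) \+ xiG u) &
        (forall u v w, P u -> is_tangent AP u v -> transverse_fibre mm u w ->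
           natural_lift phi u = tangent_map AP (frame_atlas A) id u v \+ w ->
           v = xiK u /\ w = xiG u)].
Proof.
have mP := subbundle_manifold hP.
(* The components are chosen frame by frame; outside [P] the choice is arbitrary. Smoothness and
   invariance hold for any such choice, because the decomposition is unique on [P]. *)
have /choice[f fP] : forall u, exists vw : tvec (frame A) 'cV[R]_n *
    tvec (frame A) ('cV[R]_m * 'M[R]_m)%type, P u ->
  [/\ is_tangent AP u vw.1, transverse_fibre mm u vw.2 &
      natural_lift phi u = tangent_map AP (frame_atlas A) id u vw.1 \+ vw.2].
  move=> u; have [Pu|nP] := pselect (P u); last by exists (fun=> 0, fun=> 0).
  by have [v [w vw]] := decomposition_exists hM hG hP hphi hmm Pu;
    exists (v, w).
pose xiK u := (f u).1; pose xiG u := (f u).2.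
have dec u (Pu : P u) : [/\ is_tangent AP u (xiK u), transverse_fibre mm u
  (xiG u) &
    natural_lift phi u = tangent_map AP (frame_atlas A) id u (xiK u) \+ xiG u].
  exact: fP.
have suppP u : Defs.support AP u -> P u by rewrite (manifold_support mP).
exists xiK, xiG; split.
- split=> [u /suppP Pu|d u APd du]; first by have [] := dec u Pu.
  have Pu : P u by apply: suppP; exists d.
  have [c Ac cu] := frame_chart_exists hM u.
  by have [] := decomposition_smooth hM hG hP hmm hphi dec Pu Ac APd cu du.
- exact: (kosmann_invariant hM hG hP hmm hphi dec).
- split=> [u Pu|_ u [c Ac <-] Pu cu]; first by have [] := dec u Pu.
  have [d APd du] : Defs.support AP u by rewrite (manifold_support mP).
  by have [] := decomposition_smooth hM hG hP hmm hphi dec Pu Ac APd cu du.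
- by move=> u Pu; have [] := dec u Pu.
move=> u v w Pu vt fw E; have [vt' fw' E'] := dec u Pu.
by apply: (decomposition_unique hM hG hP hmm Pu vt fw vt' fw'); rewrite -E.
Qed.
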